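(* Let $\alpha=u+iv$ with $u,v\in\mathbb{R}$, let $B\in\mathbb{C}^{2\times2}$, and let $$A=\begin{bmatrix}\alpha I & B^*+I\\ B-I & -\alpha I\end{bmatrix}\in\mathbb{C}^{4\times4}.$$ Let $\beta_1,\beta_2$ be the eigenvalues of $\operatorname{Im}B$ and let $\pm\sigma_1,\pm\sigma_2$ be the eigenvalues of $A$. Then $W(A)$ is bi-elliptical if and only if $B$ is not normal and, for an appropriate choice of the signs of $\sigma_1,\sigma_2$, $$(1+v^2)(\sigma_1+\sigma_2)^2=(\beta_1-\beta_2)^2.$$
   Context: For a square matrix $X$, $\operatorname{Im}X=(X-X^* )/(2i)$. $I$ is the $2\times2$ identity matrix. The numerical range of $A\in\mathbb{C}^{n\times n}$ is $W(A)=\{\langle Ax,x\rangle: x\in\mathbb{C}^n,\ \|x\|=1\}$. $W(A)$ is called bi-elliptical if it is the convex hull of two (non-degenerate) ellipses with distinct centers, neither of which is contained in the convex hull of the other (so that $W(A)$ is not simply an elliptical disk). Circles count as ellipses. The eigenvalues of $A$, counted with multiplicity, are $\pm\sigma_1,\pm\sigma_2$, where $\sigma_j=\sqrt{z_j+\alpha^2}$ and $z_1,z_2$ are the eigenvalues of $Z=(B-I)(B^*+I)$. The $\sigma_j$ are determined only up to sign, and the displayed condition means that the equality holds for some choice of the signs. *)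

(* Defs.v *)
From HB Require Import structures.
From mathcomp Require Export all_boot all_order all_algebra.
From mathcomp Require Export complex.
From mathcomp Require Export boolp classical_sets reals convex.

Set Implicit Arguments.
Unset Strict Implicit.
Unset Printing Implicit Defensive.

Import Order.TTheory GRing.Theory Num.Theory.

Local Open Scope classical_set_scope.
Local Open Scope ring_scope.
Local Open Scope complex_scope.
Local Open Scope sesquilinear_scope.

Definition inner (R : realType) (n : nat) (x y : 'cV[R[i]]_n) : R[i] :=
  (y^t* *m x) 0 0.

Definition cvnorm (R : realType) (n : nat) (x : 'cV[R[i]]_n) : R[i] :=
  sqrtC (inner x x).

Definition numerical_range (R : realType) (n : nat) (A : 'M[R[i]]_n) :
    set R[i] :=
  [set inner (A *m x) x | x in [set x : 'cV[R[i]]_n | cvnorm x = 1]].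

Definition Immx (R : realType) (n : nat) (X : 'M[R[i]]_n) : 'M[R[i]]_n :=
  (2 * 'i)^-1 *: (X - X^t*).

(* [Rcomplex R] is [R[i]] seen as a real vector space, so convexity is the
   usual convexity in the plane. *)
Definition convex_hull (R : realType) (S : set R[i]) : set R[i] :=
  smallest (@convex_set R (Rcomplex R)) S.

(* E is the ellipse (as a curve) with foci p, q and major axis of length r;
   the strict inequality makes it non-degenerate, and p = q gives circles. *)
Definition is_ellipse (R : realType) (c : R[i]) (E : set R[i]) : Prop :=
  exists (p q : R[i]) (r : R),
    [/\ `|p - q| < r%:C,
        c = (p + q) / 2 &
        E = [set z : R[i] | `|z - p| + `|z - q| = r%:C]].

Definition bielliptical (R : realType) (W : set R[i]) : Prop :=
  exists (E1 E2 : set R[i]) (c1 c2 : R[i]),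
    [/\ is_ellipse c1 E1 /\ is_ellipse c2 E2,
        c1 <> c2,
        ~ (E1 `<=` convex_hull E2),
        ~ (E2 `<=` convex_hull E1) &
        W = convex_hull (E1 `|` E2)].

Definition blockA (R : realType) (alpha : R[i]) (B : 'M[R[i]]_2) :
    'M[R[i]]_(2 + 2) :=
  block_mx alpha%:M   (B^t* + 1%:M)
           (B - 1%:M) (- alpha%:M).

(* The eigenvalues of X counted with algebraic multiplicity. *)
Definition eigenvalues_are (R : realType) (n : nat) (X : 'M[R[i]]_n)
    (s : seq R[i]) : Prop :=
  char_poly X = \prod_(a <- s) ('X - a%:P).

(* Main.v *)
Require Import Defs.
From mathcomp Require Import interval_inference.
From mathcomp Require Import ring lra.

(* Write B = H + iK with H, K Hermitian. For real (c, s) the square of the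
   Hermitian matrix c Re A + s Im A is block diagonal with 2x2 blocks, so the
   support function of W(A) is explicit: lam^2 = T + |c| sqrt G, where T and
   G = |c p + 2 s k|^2 are real quadratic forms in (c, s), p and k being the traceless
   parts of B^* B and K. If W(A) is bi-elliptical, one of the ellipses has a nonzero
   center and its support function f + sqrt q (f linear, q a positive definite form)
   equals lam on an open set of directions. Squaring twice gives a polynomial
   identity Y^2 = q Z^2, hence Z = 0 as q has simple conjugate roots, and this means
   T = t^2 c^2 + q, G = 4 t^2 q for a real t <> 0. Conversely, these identities give
   lam = t |c| + sqrt q, so that W(A) is the convex hull of an ellipse translated by
   t and -t. Definiteness of G says that B is not normal. The two identities
   involve T and G only through their values at (c, s) = (1, i), which are
   determined by the eigenvalues of A, and |k|^2, which is (beta1 - beta2)^2 / 4. *)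

Set Implicit Arguments.
Unset Strict Implicit.
Unset Printing Implicit Defensive.

Import Order.TTheory GRing.Theory Num.Theory.

Local Open Scope classical_set_scope.
Local Open Scope ring_scope.
Local Open Scope complex_scope.
Local Open Scope sesquilinear_scope.

Local Notation Re := complex.Re.
Local Notation Im := complex.Im.

(** * Convex hulls and ellipses *)

Section PlaneGeometry.
Variable R : realType.
Implicit Types (x y a b m n r t : R) (z c : R[i]) (S : set R[i]).

Lemma complex_eta z : z = Re z +i* Im z.
Proof. by case: z. Qed.

Lemma convex_setP S :
  @convex_set R (Rcomplex R) S <->
  (forall z c t, S z -> S c -> 0 <= t -> t <= 1 ->
     S ((t * Re z + (1 - t) * Re c) +i* (t * Im z + (1 - t) * Im c))).
Proof.
have E (k : {i01 R}) (z c : convex_lmodType (Rcomplex R)) :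
    conv k z c = (k%:num * Re z + (1 - k%:num) * Re c)
                 +i* (k%:num * Im z + (1 - k%:num) * Im c) :> R[i].
  by case: z => z1 z2; case: c => c1 c2.
split=> [cS z c t Sz Sc t0 t1|cS z c k].
  have t01 : (0 : R) <= t <= 1 by rewrite t0.
  have /set_mem := cS z c (Itv01 t0 t1) (mem_set Sz) (mem_set Sc).
  by rewrite E.
move=> /set_mem Sz /set_mem Sc; apply/mem_set; rewrite E.
exact: cS.
Qed.

Lemma convex_hull_convex S : @convex_set R (Rcomplex R) (convex_hull S).
Proof.
apply/convex_setP => z c t hz hc t0 t1 A [cA SA].
by move/convex_setP : (cA); apply => //; [exact: hz|exact: hc].
Qed.

Lemma sub_convex_hull S : S `<=` convex_hull S.
Proof. exact: sub_gen_smallest. Qed.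

Definition dot x y z : R := x * Re z + y * Im z.

Lemma convex_hull_halfplane S x y M :
  (forall z, S z -> dot x y z <= M) ->
  forall z, convex_hull S z -> dot x y z <= M.
Proof.
move=> SM; apply: smallest_sub => //.
apply/convex_setP => z c t; rewrite /dot /= => hz hc t0 t1.
have -> : x * (t * Re z + (1 - t) * Re c) + y * (t * Im z + (1 - t) * Im c) =
  t * (x * Re z + y * Im z) + (1 - t) * (x * Re c + y * Im c) by ring.
have -> : M = t * M + (1 - t) * M by ring.
by rewrite lerD // ler_wpM2l // subr_ge0.
Qed.

Lemma convex_hsegment S x1 x2 x y : @convex_set R (Rcomplex R) S ->
  S (x1 +i* y) -> S (x2 +i* y) -> x1 <= x <= x2 -> S (x +i* y).
Proof.
move=> /convex_setP cv h1 h2 /andP[x1x xx2].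
have [<-|x12] := eqVneq x1 x; first by [].
have d0 : 0 < x2 - x1.
  by rewrite subr_gt0 (lt_le_trans _ xx2) // lt_neqAle x12.
have := cv _ _ ((x2 - x) / (x2 - x1)) h1 h2; rewrite /=.
have dn0 : x2 - x1 != 0 by rewrite gt_eqF.
have -> : (x2 - x) / (x2 - x1) * x1 + (1 - (x2 - x) / (x2 - x1)) * x2 = x.
  by field.
have -> t : t * y + (1 - t) * y = y by ring.
apply; first by apply: divr_ge0; [rewrite subr_ge0|exact: ltW].
by rewrite ler_pdivrMr // mul1r lerD2l lerN2.
Qed.

(* The affine image of the unit circle under a matrix that maps horizontal lines
   to horizontal lines; every non-degenerate ellipse has this form
   ([is_ellipseP]). *)
Definition ell c m n r : set R[i] :=
  [set z | exists a b, a ^+ 2 + b ^+ 2 = 1 /\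
     z = (Re c + (m * a + n * b)) +i* (Im c + r * b)].

(** The support function of [ell c m n r]: at the parameter [(a, b)] the pairing with [(x, y)] is
    that of the center plus the dot product of [(a, b)] with [(m x, n x + r y)], and a unit vector
    maximizes the latter to the norm. *)
Definition supp c m n r x y : R :=
  dot x y c + Num.sqrt ((m * x) ^+ 2 + (n * x + r * y) ^+ 2).

Lemma cauchy2 a b x y : a ^+ 2 + b ^+ 2 <= 1 ->
  a * x + b * y <= Num.sqrt (x ^+ 2 + y ^+ 2).
Proof.
move=> ab; apply: (le_trans (ler_norm _)); rewrite -sqrtr_sqr ler_wsqrtr //.
(* Lagrange's identity: this square is the defect in the Cauchy-Schwarz inequality. *)
have h : 0 <= (a * y - b * x) ^+ 2 by exact: sqr_ge0.
have h2 : 0 <= (1 - (a ^+ 2 + b ^+ 2)) * (x ^+ 2 + y ^+ 2).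
  by rewrite mulr_ge0 ?subr_ge0 // addr_ge0 ?sqr_ge0.
by nra.
Qed.

Lemma unit_vec x y : exists a b, a ^+ 2 + b ^+ 2 = 1 /\
  a * x + b * y = Num.sqrt (x ^+ 2 + y ^+ 2).
Proof.
set s := Num.sqrt _.
have s2 : s ^+ 2 = x ^+ 2 + y ^+ 2 by rewrite sqr_sqrtr ?addr_ge0 ?sqr_ge0.
have [s0|s0] := eqVneq s 0.
  exists 1, 0; split; first by ring.
  have : x ^+ 2 + y ^+ 2 = 0 by rewrite -s2 s0 expr0n.
  by move/eqP; rewrite paddr_eq0 ?sqr_ge0 // !sqrf_eq0 s0 => /andP[/eqP-> _]; ring.
exists (x / s), (y / s); split.
  have -> : (x / s) ^+ 2 + (y / s) ^+ 2 = (x ^+ 2 + y ^+ 2) / s ^+ 2 by field.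
  by rewrite -s2 divff // sqrf_eq0.
have -> : x / s * x + y / s * y = (x ^+ 2 + y ^+ 2) / s by field.
by rewrite -s2 expr2 mulfK.
Qed.

Lemma ell_le_supp c m n r z x y : ell c m n r z -> dot x y z <= supp c m n r x y.
Proof.
move=> [a [b [ab ->]]]; rewrite /supp /dot /=.
have := @cauchy2 a b (m * x) (n * x + r * y).
rewrite ab => /(_ (lexx _)) h; move: h; set s := Num.sqrt _ => h.
have -> : x * (Re c + (m * a + n * b)) + y * (Im c + r * b) =
  x * Re c + y * Im c + (a * (m * x) + b * (n * x + r * y)) by ring.
by rewrite lerD2l.
Qed.

Lemma ell_supp_attained c m n r x y :
  exists2 z, ell c m n r z & dot x y z = supp c m n r x y.
Proof.
have [a [b [ab e]]] := unit_vec (m * x) (n * x + r * y).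
exists ((Re c + (m * a + n * b)) +i* (Im c + r * b)); first by exists a, b.
by rewrite /supp -e /dot /=; ring.
Qed.

(** The horizontal chord of the unit disk through [(a, b)] maps to a horizontal chord of the
    ellipse, whose ends lie on the curve. *)
Lemma ell_chord c m n r a b : 0 < m -> a ^+ 2 + b ^+ 2 <= 1 ->
  convex_hull (ell c m n r) ((Re c + (m * a + n * b)) +i* (Im c + r * b)).
Proof.
move=> m0 ab; pose d := Num.sqrt (1 - b ^+ 2).
have d2 : d ^+ 2 = 1 - b ^+ 2.
  by rewrite sqr_sqrtr // subr_ge0 (le_trans _ ab) // lerDr sqr_ge0.
have d0 : 0 <= d by exact: sqrtr_ge0.
have [l1 l2] : - d <= a /\ a <= d.
  have : `|a| <= d.
    by rewrite -(@ler_pXn2r _ 2) ?nnegrE // d2 real_normK ?num_real // lerBrDr.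
  by rewrite ler_norml => /andP[].
apply: (@convex_hsegment _ (Re c + (m * - d + n * b)) (Re c + (m * d + n * b))).
- exact: convex_hull_convex.
- by apply: sub_convex_hull; exists (- d), b; split => //; rewrite sqrrN d2; ring.
- by apply: sub_convex_hull; exists d, b; split => //; rewrite d2; ring.
- by rewrite !lerD2l !lerD2r !ler_pM2l // l1.
Qed.

Lemma supp_le_hull c m n r z : 0 < m -> 0 < r ->
  (forall x y, dot x y z <= supp c m n r x y) -> convex_hull (ell c m n r) z.
Proof.
move=> m0 r0 H.
have [mn rn] : m != 0 /\ r != 0 by rewrite !gt_eqF.
pose b := (Im z - Im c) / r; pose a := (Re z - Re c - n * b) / m.
have E : z = (Re c + (m * a + n * b)) +i* (Im c + r * b).
  by rewrite [LHS]complex_eta; congr (_ +i* _); rewrite /a /b; field;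
    rewrite ?mn ?rn.
rewrite E; apply: ell_chord => //.
(* One direction suffices: its pullback to the disk is [(a, b)] itself, so the hypothesis says that
   the norm [s] of [(a, b)] satisfies [s ^+ 2 <= s]. *)
have := H (a / m) ((b - n * (a / m)) / r).
rewrite {1}E /supp /dot /=.
have -> : m * (a / m) = a by field.
have -> : n * (a / m) + r * ((b - n * (a / m)) / r) = b by field; rewrite mn rn.
set s := Num.sqrt _ => h.
have s0 : 0 <= s by exact: sqrtr_ge0.
have s2 : s ^+ 2 = a ^+ 2 + b ^+ 2 by rewrite sqr_sqrtr ?addr_ge0 ?sqr_ge0.
have {}h : s ^+ 2 <= s.
  rewrite s2 -(lerD2l (a / m * Re c + (b - n * (a / m)) / r * Im c)).
  apply: le_trans h; rewrite le_eqVlt; apply/orP; left; apply/eqP.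
  by field; rewrite mn rn.
rewrite -s2; nra.
Qed.

End PlaneGeometry.

(** * Focal and parametric forms of an ellipse *)

Section Ellipses.
Variable R : realType.
Implicit Types (x y a b m n r t : R) (z c : R[i]).

Lemma focal_equation f1 f2 A x y : 0 < A -> f1 ^+ 2 + f2 ^+ 2 < A ^+ 2 ->
  Num.sqrt ((x - f1) ^+ 2 + (y - f2) ^+ 2) +
  Num.sqrt ((x + f1) ^+ 2 + (y + f2) ^+ 2) = 2 * A <->
  (A ^+ 2 - (f1 ^+ 2 + f2 ^+ 2)) * (x ^+ 2 + y ^+ 2) + (f2 * x - f1 * y) ^+ 2 =
  (A ^+ 2 - (f1 ^+ 2 + f2 ^+ 2)) * A ^+ 2.
Proof.
move=> A0 fA; set P := Num.sqrt _; set M := Num.sqrt _.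
have P0 : 0 <= P by exact: sqrtr_ge0.
have M0 : 0 <= M by exact: sqrtr_ge0.
have P2 : P ^+ 2 = (x - f1) ^+ 2 + (y - f2) ^+ 2.
  by rewrite sqr_sqrtr ?addr_ge0 ?sqr_ge0.
have M2 : M ^+ 2 = (x + f1) ^+ 2 + (y + f2) ^+ 2.
  by rewrite sqr_sqrtr ?addr_ge0 ?sqr_ge0.
have PM2 : (P * M) ^+ 2 = ((x - f1) ^+ 2 + (y - f2) ^+ 2) *
    ((x + f1) ^+ 2 + (y + f2) ^+ 2) by rewrite exprMn P2 M2.
split=> [E|E].
  have PM : P * M = 2 * A ^+ 2 - (x ^+ 2 + y ^+ 2 + f1 ^+ 2 + f2 ^+ 2).
    have : (P + M) ^+ 2 = 4 * A ^+ 2 by rewrite E; ring.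
    rewrite sqrrD P2 M2; lra.
  by move: PM2; rewrite PM => h; lra.
(* A point of the conic is within [A] of the center. This makes the value claimed for [P * M]
   nonnegative, so that it may be identified by its square. *)
have z2 : x ^+ 2 + y ^+ 2 <= A ^+ 2.
  have : 0 < A ^+ 2 - (f1 ^+ 2 + f2 ^+ 2) by rewrite subr_gt0.
  have := sqr_ge0 (f2 * x - f1 * y); nra.
have PM : P * M = 2 * A ^+ 2 - (x ^+ 2 + y ^+ 2 + f1 ^+ 2 + f2 ^+ 2).
  have PM0 : 0 <= P * M by exact: mulr_ge0.
  have h0 : 0 <= 2 * A ^+ 2 - (x ^+ 2 + y ^+ 2 + f1 ^+ 2 + f2 ^+ 2) by lra.
  by apply/eqP; rewrite -(@eqrXn2 _ 2) //; apply/eqP; rewrite PM2; lra.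
have A20 : 0 <= 2 * A by lra.
have PM0 : 0 <= P + M by exact: addr_ge0.
apply/eqP; rewrite -(@eqrXn2 _ 2) //.
by apply/eqP; rewrite sqrrD P2 M2 mulr2n PM; ring.
Qed.

Lemma mem_ell c m n r x y : 0 < m -> 0 < r ->
  ell c m n r (x +i* y) <->
  (r * (x - Re c) - n * (y - Im c)) ^+ 2 + m ^+ 2 * (y - Im c) ^+ 2 =
  (m * r) ^+ 2.
Proof.
move=> m0 r0; have [mn rn] : m != 0 /\ r != 0 by rewrite !gt_eqF.
split=> [[a [b [ab [-> ->]]]]|E].
  by rewrite -[RHS]mulr1 -ab; ring.
exists ((r * (x - Re c) - n * (y - Im c)) / (m * r)), ((y - Im c) / r).
split; last by congr (_ +i* _); field; rewrite ?mn ?rn.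
have -> : ((r * (x - Re c) - n * (y - Im c)) / (m * r)) ^+ 2 + ((y - Im c) / r) ^+ 2
 = ((r * (x - Re c) - n * (y - Im c)) ^+ 2 + m ^+ 2 * (y - Im c) ^+ 2) / (m * r) ^+ 2.
  by field; rewrite mn rn.
by rewrite E divff // expf_neq0 // mulf_neq0.
Qed.

(** The last three hypotheses match the coefficients of the quadratic forms in [mem_ell] and
    [focal_equation]. *)
Lemma ell_foci (c p q : R[i]) f1 f2 A m n r :
  0 < A -> 0 < m -> 0 < r -> f1 ^+ 2 + f2 ^+ 2 < A ^+ 2 ->
  p = c + (f1 +i* f2) -> q = c - (f1 +i* f2) ->
  r ^+ 2 = A ^+ 2 - f1 ^+ 2 -> n * r = f1 * f2 ->
  m ^+ 2 + n ^+ 2 = A ^+ 2 - f2 ^+ 2 ->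
  [set z : R[i] | `|z - p| + `|z - q| = (2 * A)%:C] = ell c m n r.
Proof.
move=> A0 m0 r0 fA -> -> hr hn hm; apply/seteqP; split=> -[x y] /=.
all: case: c => c1 c2; rewrite mem_ell //= !normc_def -rmorphD /=.
all: have -> : x - (c1 + f1) = x - c1 - f1 by ring.
all: have -> : y - (c2 + f2) = y - c2 - f2 by ring.
all: have -> : x - (c1 - f1) = x - c1 + f1 by ring.
all: have -> : y - (c2 - f2) = y - c2 + f2 by ring.
all: have e X Y : (r * X - n * Y) ^+ 2 + m ^+ 2 * Y ^+ 2 =
  (A ^+ 2 - (f1 ^+ 2 + f2 ^+ 2)) * (X ^+ 2 + Y ^+ 2) + (f2 * X - f1 * Y) ^+ 2.
all: try by (have -> : (r * X - n * Y) ^+ 2 + m ^+ 2 * Y ^+ 2 =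
   r ^+ 2 * X ^+ 2 - 2 * (n * r) * X * Y + (m ^+ 2 + n ^+ 2) * Y ^+ 2 by ring);
   rewrite hr hn hm; ring.
all: have emr : (m * r) ^+ 2 = (A ^+ 2 - (f1 ^+ 2 + f2 ^+ 2)) * A ^+ 2.
all: try by (have -> : (m * r) ^+ 2 = (m ^+ 2 + n ^+ 2) * r ^+ 2 - (n * r) ^+ 2 by ring);
   rewrite hr hn hm; ring.
all: rewrite e emr.
  by move/complexI/focal_equation; apply.
by move=> h; congr (_ %:C); apply/focal_equation.
Qed.

Lemma is_ellipseP c (E : set R[i]) :
  is_ellipse c E <-> exists m n r, [/\ 0 < m, 0 < r & E = ell c m n r].
Proof.
split=> [[p [q [rho [pq cE ->]]]]|[m [n [r [m0 r0 ->]]]]].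
  case: p pq cE => p1 p2; case: q => q1 q2; rewrite normc_def ltcR /= => pq cE.
  pose f1 := (p1 - q1) / 2; pose f2 := (p2 - q2) / 2; pose A := rho / 2.
  have rho0 : 0 < rho by rewrite (le_lt_trans _ pq) // sqrtr_ge0.
  have A0 : 0 < A by rewrite divr_gt0.
  have fA : f1 ^+ 2 + f2 ^+ 2 < A ^+ 2.
    have : (p1 - q1) ^+ 2 + (p2 - q2) ^+ 2 < rho ^+ 2.
      rewrite -(@ltr_sqrt _ _ (rho ^+ 2)) ?exprn_gt0 // sqrtr_sqr gtr0_norm //.
    by rewrite /f1 /f2 /A; lra.
  have r20 : 0 < A ^+ 2 - f1 ^+ 2 by have := sqr_ge0 f2; lra.
  pose r := Num.sqrt (A ^+ 2 - f1 ^+ 2).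
  have r0 : 0 < r by rewrite sqrtr_gt0.
  have r2 : r ^+ 2 = A ^+ 2 - f1 ^+ 2 by rewrite sqr_sqrtr // ltW.
  have rn : r != 0 by rewrite gt_eqF.
  pose n := f1 * f2 / r.
  have m20 : 0 < A ^+ 2 - f2 ^+ 2 - n ^+ 2.
    have -> : A ^+ 2 - f2 ^+ 2 - n ^+ 2 =
      (r ^+ 2 * (A ^+ 2 - f2 ^+ 2) - (f1 * f2) ^+ 2) / r ^+ 2 by rewrite /n; field.
    rewrite divr_gt0 ?exprn_gt0 // r2.
    have -> : (A ^+ 2 - f1 ^+ 2) * (A ^+ 2 - f2 ^+ 2) - (f1 * f2) ^+ 2 =
      A ^+ 2 * (A ^+ 2 - (f1 ^+ 2 + f2 ^+ 2)) by ring.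
    by rewrite mulr_gt0 ?exprn_gt0 // subr_gt0.
  pose m := Num.sqrt (A ^+ 2 - f2 ^+ 2 - n ^+ 2).
  exists m, n, r; split => //; first by rewrite sqrtr_gt0.
  have -> : rho = 2 * A by rewrite /A; field.
  apply: (@ell_foci c _ _ f1 f2) => //.
  - by rewrite sqrtr_gt0.
  - rewrite cE; apply/eqP; rewrite -subr_eq0 mulrC.
    have -> : (2 : R[i])^-1 = (2^-1 : R)%:C by rewrite fmorphV rmorph_nat.
    by apply/eqP; congr (_ +i* _) => /=; rewrite /f1 /f2; field.
  - rewrite cE; apply/eqP; rewrite -subr_eq0 mulrC.
    have -> : (2 : R[i])^-1 = (2^-1 : R)%:C by rewrite fmorphV rmorph_nat.
    by apply/eqP; congr (_ +i* _) => /=; rewrite /f1 /f2; field.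
  - by rewrite /n divfK.
  - by rewrite sqr_sqrtr ?ltW //; ring.
(* the foci are the square roots of [(m^2+n^2-r^2) + 2inr] *)
pose w : R[i] := (m ^+ 2 + n ^+ 2 - r ^+ 2) +i* (2 * (n * r)).
have := sqr_sqrtc w; case: (sqrtc w) => f1 f2; rewrite expr2 /w => -[e1 e2].
have e3 : n * r = f1 * f2 by lra.
have A20 : 0 < r ^+ 2 + f1 ^+ 2 by rewrite ltr_pwDl ?exprn_gt0 ?sqr_ge0.
pose A := Num.sqrt (r ^+ 2 + f1 ^+ 2).
have A0 : 0 < A by rewrite sqrtr_gt0.
have A2 : A ^+ 2 = r ^+ 2 + f1 ^+ 2 by rewrite sqr_sqrtr // ltW.
have fA : f1 ^+ 2 + f2 ^+ 2 < A ^+ 2.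
  rewrite A2 addrC ltrD2r.
  (* In terms of the foci this square is (r^2 - f2^2)(r^2 + f1^2), so its positivity forces f2^2 <
     r^2. *)
  have : 0 < (m * r) ^+ 2 by rewrite exprn_gt0 // mulr_gt0.
  have -> : (m * r) ^+ 2 = (m ^+ 2 + n ^+ 2) * r ^+ 2 - (n * r) ^+ 2 by ring.
  have -> : m ^+ 2 + n ^+ 2 = r ^+ 2 + f1 ^+ 2 - f2 ^+ 2 by lra.
  rewrite e3 => h; rewrite ltNge; apply/negP => h2.
  have := sqr_ge0 f1; have := sqr_ge0 r; nra.
exists (c + (f1 +i* f2)), (c - (f1 +i* f2)), (2 * A); split.
- have -> : c + (f1 +i* f2) - (c - (f1 +i* f2)) = (2 * f1) +i* (2 * f2).
    by case: c => c1 c2; congr (_ +i* _) => /=; ring.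
  rewrite normc_def ltcR /=.
  have -> : 2 * A = Num.sqrt ((2 * A) ^+ 2) by rewrite sqrtr_sqr gtr0_norm // mulr_gt0.
  by rewrite ltr_sqrt ?exprn_gt0 ?mulr_gt0 //; lra.
- by field.
- by rewrite (@ell_foci c _ _ f1 f2 A m n r) //; lra.
Qed.

End Ellipses.

(** * Numerical ranges are convex *)

Section NumericalRange.
Variables (R : realType) (k : nat).
Implicit Types (x y : 'cV[R[i]]_k) (A : 'M[R[i]]_k).

Lemma innerE x y : inner x y = \sum_i x i 0 * conjc (y i 0).
Proof. by rewrite /inner mxE; apply: eq_bigr => i _; rewrite !mxE mulrC. Qed.

Lemma innerDl x x' y : inner (x + x') y = inner x y + inner x' y.
Proof. by rewrite /inner mulmxDr mxE. Qed.

Lemma innerDr x y y' : inner x (y + y') = inner x y + inner x y'.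
Proof.
by rewrite !innerE -big_split; apply: eq_bigr => i _; rewrite /= mxE rmorphD mulrDr.
Qed.

Lemma innerZl a x y : inner (a *: x) y = a * inner x y.
Proof. by rewrite /inner -scalemxAr mxE. Qed.

Lemma innerZr a x y : inner x (a *: y) = conjc a * inner x y.
Proof.
by rewrite !innerE mulr_sumr; apply: eq_bigr => i _; rewrite /= mxE rmorphM mulrCA.
Qed.

Lemma inner_ge0 x : 0 <= inner x x.
Proof. by rewrite innerE sumr_ge0 // => i _; rewrite mulcJ_ge0. Qed.

Lemma inner_eq0 x : inner x x = 0 -> x = 0.
Proof.
rewrite innerE => /eqP; rewrite psumr_eq0 => [/allP h|i _]; last exact: mulcJ_ge0.
apply/colP => i; rewrite mxE; apply/eqP.
by have := h i (mem_index_enum _); rewrite /= mulf_eq0 conjc_eq0 orbb.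
Qed.

Lemma numerical_rangeP A z : numerical_range A z <->
  exists2 x, inner x x = 1 & inner (A *m x) x = z.
Proof.
split=> -[x]; rewrite /cvnorm /=.
  by move=> x1 <-; exists x => //; rewrite -[LHS]sqrtCK x1 expr1n.
by move=> x1 <-; exists x => //; rewrite /= /cvnorm x1 sqrtC1.
Qed.

Lemma numerical_range_scale A z x : inner x x != 0 ->
  inner (A *m x) x = z * inner x x -> numerical_range A z.
Proof.
move=> x0 e; apply/numerical_rangeP.
have xp : 0 < inner x x by rewrite lt_neqAle eq_sym x0 inner_ge0.
pose s := sqrtC (inner x x).
have s2 : s * s = inner x x by rewrite -expr2 sqrtCK.
have sp : 0 < s by rewrite sqrtC_gt0.
have sj : conjc s^-1 = s^-1.
  by rewrite conjc_inv -(RRe_real (ger0_real (ltW sp))) conjc_real.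
have sn : s != 0 by rewrite gt_eqF.
exists (s^-1 *: x).
  by rewrite innerZl innerZr sj -s2; field.
by rewrite -scalemxAr innerZl innerZr sj e -s2; field.
Qed.

(* Toeplitz-Hausdorff: after a unimodular rescaling of [x], the equation
   <(A - zeta)u, u> = 0 along u = x + tau y becomes a real quadratic equation
   in tau whose constant and leading coefficients have opposite signs. *)
Theorem numerical_range_convex A :
  @convex_set R (Rcomplex R) (numerical_range A).
Proof.
apply/convex_setP => z w t hz hw t0 t1.
set zeta := _ +i* _.
have zE : zeta = t%:C * z + (1 - t)%:C * w.
  by rewrite /zeta; case: z {hz zeta} => ? ?; case: w {hw} => ? ?;
    congr (_ +i* _) => /=; ring.
have [zw|zw] := eqVneq z w.
  suff -> : zeta = z by [].
  by rewrite zE -zw -mulrDl -rmorphD addrC subrK mul1r.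
have [t_0|tn0] := eqVneq t 0.
  by suff -> : zeta = w by []; rewrite zE t_0 subr0 mul0r mul1r add0r.
have tp : 0 < t by rewrite lt_neqAle eq_sym tn0.
move: hz hw => /numerical_rangeP [x x1 xz] /numerical_rangeP [y y1 yw].
have d0 : z - w != 0 by rewrite subr_eq0.
(* [P] and [Q] are the cross terms of <(A - zeta)u, u>, divided by [z - w]; in this unit the
   diagonal terms are [1 - t] and [- t]. *)
set P := (inner (A *m x) y - zeta * inner x y) / (z - w).
set Q := (inner (A *m y) x - zeta * inner y x) / (z - w).
(* With [mu = - b + i a], the imaginary part of [mu * P + conjc mu * Q] is the determinant of these
   two parallel vectors, hence zero. *)
have [a [b [ab e]]] := unit_vec (Im P + Im Q) (Re P - Re Q).
have {}e : a * (Re P - Re Q) - b * (Im P + Im Q) = 0.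
  move: e; set X := Im P + Im Q; set Y := Re P - Re Q => e; apply/eqP.
  rewrite -sqrf_eq0; apply/eqP.
  have e2 : (a * X + b * Y) ^+ 2 = X ^+ 2 + Y ^+ 2.
    rewrite e sqr_sqrtr //; apply: addr_ge0; exact: sqr_ge0.
  have -> : (a * Y - b * X) ^+ 2 =
    (a ^+ 2 + b ^+ 2) * (X ^+ 2 + Y ^+ 2) - (a * X + b * Y) ^+ 2 by ring.
  by rewrite ab e2 mul1r subrr.
pose mu : R[i] := (- b) +i* a.
have mumu : mu * conjc mu = 1.
  by congr (_ +i* _) => /=; [rewrite -ab; ring|ring].
pose M := Re (mu * P + conjc mu * Q).
have ME : mu * P + conjc mu * Q = M%:C.
  rewrite [LHS]complex_eta -/M; congr (_ +i* _); move: e.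
  by rewrite /mu; case: (P) => ? ?; case: (Q) => ? ? /= <-; ring.
pose D := M ^+ 2 + 4 * t * (1 - t).
have D0 : 0 <= D by apply: addr_ge0; [exact: sqr_ge0|rewrite !mulr_ge0 // ?subr_ge0].
(* A root of the real quadratic in [tauE], whose discriminant is [D]. *)
pose tau := (M + Num.sqrt D) / (2 * t).
have tauE : (1 - t) + tau * M - t * tau ^+ 2 = 0.
  have : Num.sqrt D ^+ 2 = D by rewrite sqr_sqrtr.
  rewrite /tau; set s := Num.sqrt D => sD.
  have -> : (1 - t) + (M + s) / (2 * t) * M - t * ((M + s) / (2 * t)) ^+ 2 =
    (M ^+ 2 + 4 * t * (1 - t) - s ^+ 2) / (4 * t) by field.
  by rewrite sD /D subrr mul0r.
pose u := mu *: x + tau%:C *: y.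
have tJ : conjc tau%:C = tau%:C :> R[i] by exact: conjc_real.
have tJN : conjc (- tau%:C) = - tau%:C :> R[i] by rewrite -rmorphN; exact: conjc_real.
have uu : inner u u = 1 + tau%:C ^+ 2 +
    tau%:C * (mu * inner x y + conjc mu * inner y x).
  transitivity (mu * conjc mu * inner x x + tau%:C ^+ 2 * inner y y +
      tau%:C * (mu * inner x y + conjc mu * inner y x)).
    by rewrite /u !innerDl !innerDr !innerZl !innerZr tJ; ring.
  by rewrite mumu x1 y1 !mulr1.
have Auu : inner (A *m u) u = z + tau%:C ^+ 2 * w +
    tau%:C * (mu * inner (A *m x) y + conjc mu * inner (A *m y) x).
  transitivity (mu * conjc mu * inner (A *m x) x + tau%:C ^+ 2 * inner (A *m y) y +
      tau%:C * (mu * inner (A *m x) y + conjc mu * inner (A *m y) x)).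
    by rewrite /u mulmxDr -!scalemxAr !innerDl !innerDr !innerZl !innerZr tJ; ring.
  by rewrite mumu xz yw mul1r.
apply: (@numerical_range_scale _ _ u).
  (* If [u = 0], then [x] and [y] are unit vectors on one complex line and give the same value,
     against [z != w]. *)
  apply/eqP => /inner_eq0 u0.
  have xE : mu *: x = - tau%:C *: y.
    by apply/eqP; rewrite scaleNr -addr_eq0 -/u u0.
  have tau2 : tau%:C ^+ 2 = 1 :> R[i].
    have : inner (mu *: x) (mu *: x) = 1 by rewrite innerZl innerZr mulrA mumu x1 mulr1.
    rewrite xE innerZl innerZr y1 mulr1 => <-.
    by rewrite tJN; ring.
  have : inner (A *m (mu *: x)) (mu *: x) = z.
    by rewrite -scalemxAr innerZl innerZr mulrA mumu xz mul1r.
  rewrite xE -scalemxAr innerZl innerZr yw tJN mulrA mulrNN -expr2 tau2 mul1r.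
  by move/eqP; rewrite eq_sym (negPf zw).
apply/eqP; rewrite -subr_eq0; apply/eqP.
have e1 : mu * (inner (A *m x) y - zeta * inner x y) +
    conjc mu * (inner (A *m y) x - zeta * inner y x) = M%:C * (z - w).
  by rewrite -ME /P /Q; field.
have -> : inner (A *m u) u - zeta * inner u u = (z - zeta) + tau%:C ^+ 2 * (w - zeta)
   + tau%:C * (mu * (inner (A *m x) y - zeta * inner x y) +
    conjc mu * (inner (A *m y) x - zeta * inner y x)).
  by rewrite uu Auu; ring.
rewrite e1 zE.
have -> : (1 - t)%:C = 1 - t%:C :> R[i] by rewrite rmorphB.
have -> : z - (t%:C * z + (1 - t%:C) * w) + tau%:C ^+ 2 * (w - (t%:C * z + (1 - t%:C) * w)) +
  tau%:C * (M%:C * (z - w)) =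
  ((1 - t%:C) + tau%:C * M%:C - t%:C * tau%:C ^+ 2) * (z - w) by ring.
have -> : 1 - t%:C + tau%:C * M%:C - t%:C * tau%:C ^+ 2 =
  ((1 - t) + tau * M - t * tau ^+ 2)%:C :> R[i].
  by rewrite rmorphB rmorphD rmorphB !rmorphM expr2.
by rewrite tauE mul0r.
Qed.

End NumericalRange.

(** * Quadratic forms on C^2 *)

Section TwoByTwo.

Lemma ord2P (P : 'I_2 -> Prop) : P 0 -> P 1 -> forall i, P i.
Proof.
move=> P0 P1 [[|[|//]] i2]; first by rewrite (_ : Ordinal _ = 0) //; apply/val_inj.
by rewrite (_ : Ordinal _ = 1) //; apply/val_inj.
Qed.

Lemma sum2 (K : nmodType) (F : 'I_2 -> K) : \sum_i F i = F 0 + F 1.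
Proof.
rewrite !big_ord_recl big_ord0 addr0.
by have -> : lift ord0 ord0 = 1 :> 'I_2 by apply/val_inj.
Qed.

Lemma mulmx2 (K : pzRingType) m n (M : 'M[K]_(m, 2)) (N : 'M[K]_(2, n)) i j :
  (M *m N) i j = M i 0 * N 0 j + M i 1 * N 1 j.
Proof. by rewrite mxE sum2. Qed.

Lemma det2 (K : comNzRingType) (M : 'M[K]_2) :
  \det M = M 0 0 * M 1 1 - M 0 1 * M 1 0.
Proof.
rewrite (expand_det_row _ 0) sum2 /cofactor !det_mx11 !mxE.
have -> : lift 0 0 = 1 :> 'I_2 by apply/val_inj.
have -> : lift 1 0 = 0 :> 'I_2 by apply/val_inj.
by rewrite expr0 expr1 mul1r mulN1r mulrN.
Qed.

Lemma char_poly2 (F : fieldType) (M : 'M[F]_2) a b :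
  char_poly M = \prod_(c <- [:: a; b]) ('X - c%:P) ->
  a + b = \tr M /\ a * b = \det M.
Proof.
move=> E; split.
  have := char_poly_trace M isT; rewrite E.
  rewrite !big_cons big_nil mulr1 /=.
  have -> : ('X - a%:P) * ('X - b%:P) = 'X^2 + (- (a + b))%:P * 'X + (a * b)%:P.
    by rewrite polyCN polyCD polyCM; ring.
  rewrite !coefE /= => h; apply/eqP; rewrite -eqr_opp -h; apply/eqP; ring.
have := char_poly_det M; rewrite E -horner_coef0 !big_cons big_nil !hornerE.
rewrite sqrrN expr1n mul1r => <- /=; ring.
Qed.

End TwoByTwo.

(** * Bloch vectors and the quadratic forms of Hermitian 2x2 matrices *)

Section SpinGeometry.
Variable R : realType.
Implicit Types (a b c s m n : R) (x y z : 'cV[R[i]]_2).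

Lemma inner2 x y :
  inner x y = x 0 0 * conjc (y 0 0) + x 1 0 * conjc (y 1 0).
Proof. by rewrite innerE sum2. Qed.

Lemma inner_col_mx (x y x' y' : 'cV[R[i]]_2) :
  inner (col_mx x y) (col_mx x' y') = inner x x' + inner y y'.
Proof.
rewrite !innerE big_split_ord /=.
by congr (_ + _); apply: eq_bigr => i _; rewrite ?col_mxEu ?col_mxEd.
Qed.

(* The Bloch vector of a spinor, so that a Hermitian matrix m0 + m.sigma has
   quadratic form m0 |y|^2 + m.bloch y. *)
Definition bloch1 y := Re (2 * conjc (y 0 0) * y 1 0).
Definition bloch2 y := Im (2 * conjc (y 0 0) * y 1 0).
Definition bloch3 y := Re (y 0 0 * conjc (y 0 0) - y 1 0 * conjc (y 1 0)).

Lemma inner_self y : inner y y = (Re (inner y y))%:C.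
Proof. by rewrite inner2; case: (y 0 0) (y 1 0) => ? ? [? ?]; congr (_ +i* _) => /=; ring. Qed.

Lemma Re_inner_ge0 y : 0 <= Re (inner y y).
Proof. by rewrite inner2; case: (y 0 0) (y 1 0) => ? ? [? ?] /=; nra. Qed.

Lemma bloch_norm y :
  bloch1 y ^+ 2 + bloch2 y ^+ 2 + bloch3 y ^+ 2 = Re (inner y y) ^+ 2.
Proof.
rewrite inner2 /bloch1 /bloch2 /bloch3.
by case: (y 0 0) (y 1 0) => ? ? [? ?] /=; ring.
Qed.

Lemma Re_inner_cauchy y z : Re (inner y z) ^+ 2 <= Re (inner y y) * Re (inner z z).
Proof.
rewrite !inner2.
case: (y 0 0) (y 1 0) (z 0 0) (z 1 0) => a b [c d] [a' b'] [c' d'] /=.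
rewrite -subr_ge0; set X := (X in 0 <= X).
have -> : X = (a * b' - b * a') ^+ 2 + (a * c' - c * a') ^+ 2 +
  (a * d' - d * a') ^+ 2 + (b * c' - c * b') ^+ 2 + (b * d' - d * b') ^+ 2 +
  (c * d' - d * c') ^+ 2 by rewrite /X; ring.
by rewrite !addr_ge0 ?sqr_ge0.
Qed.

Lemma half_angle a b : a ^+ 2 + b ^+ 2 = 1 -> exists m n,
  [/\ m ^+ 2 + n ^+ 2 = 1, m ^+ 2 - n ^+ 2 = a & 2 * m * n = b].
Proof.
move=> ab.
have [a1|a1] := eqVneq a (-1).
  exists 0, 1; split; [ring|rewrite a1; ring|].
  have : b ^+ 2 = 0 by move: ab; rewrite a1 => ab; lra.
  by move/eqP; rewrite sqrf_eq0 => /eqP ->; ring.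
have a0 : 0 < (1 + a) / 2.
  have : - 1 <= a by have := sqr_ge0 b; nra.
  by rewrite le_eqVlt eq_sym (negPf a1) /=; lra.
pose m := Num.sqrt ((1 + a) / 2).
have m2 : m ^+ 2 = (1 + a) / 2 by rewrite sqr_sqrtr // ltW.
have mn : m != 0 by rewrite gt_eqF // sqrtr_gt0.
exists m, (b / (2 * m)).
have e : (b / (2 * m)) ^+ 2 = (1 - a) / 2.
  have -> : (b / (2 * m)) ^+ 2 = b ^+ 2 / (4 * m ^+ 2) by field.
  have -> : b ^+ 2 = (1 - a) * (1 + a) by have := ab; lra.
  by rewrite m2; field; lra.
by split; rewrite ?e ?m2; field.
Qed.

Lemma bloch_surj n1 n2 n3 : n1 ^+ 2 + n2 ^+ 2 + n3 ^+ 2 = 1 ->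
  exists y, [/\ inner y y = 1, bloch1 y = n1, bloch2 y = n2 & bloch3 y = n3].
Proof.
move=> nn.
(* The phase is free, so the first coordinate of the spinor may be taken real. *)
suff [y1 [y2 [y3 [e0 e1 e2 e3]]]] : exists a b c,
    [/\ a ^+ 2 + b ^+ 2 + c ^+ 2 = 1, 2 * a * b = n1, 2 * a * c = n2 &
     a ^+ 2 - b ^+ 2 - c ^+ 2 = n3].
  exists (\col_i if i == 0 then y1%:C else y2 +i* y3).
  rewrite inner2 /bloch1 /bloch2 /bloch3 !mxE /=; split.
  - by congr (_ +i* _) => /=; rewrite -?e0; ring.
  - by rewrite -e1; ring.
  - by rewrite -e2; ring.
  - by rewrite -e3; ring.
(* At the south pole the first coordinate vanishes and the general formula would divide by zero. *)
have [n31|n31] := eqVneq n3 (-1).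
  exists 0, 1, 0.
  have : n1 ^+ 2 + n2 ^+ 2 = 0 by move: nn; rewrite n31 => nn; lra.
  move/eqP; rewrite paddr_eq0 ?sqr_ge0 // !sqrf_eq0 => /andP[/eqP-> /eqP->].
  by rewrite n31; split; ring.
have a0 : 0 < (1 + n3) / 2.
  have : - 1 <= n3 by have := sqr_ge0 n1; have := sqr_ge0 n2; nra.
  by rewrite le_eqVlt eq_sym (negPf n31) /=; lra.
pose m := Num.sqrt ((1 + n3) / 2).
have m2 : m ^+ 2 = (1 + n3) / 2 by rewrite sqr_sqrtr // ltW.
have mn : m != 0 by rewrite gt_eqF // sqrtr_gt0.
have e : (n1 / (2 * m)) ^+ 2 + (n2 / (2 * m)) ^+ 2 = (1 - n3) / 2.
  have -> : (n1 / (2 * m)) ^+ 2 + (n2 / (2 * m)) ^+ 2 =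
     (n1 ^+ 2 + n2 ^+ 2) / (4 * m ^+ 2) by field.
  have -> : n1 ^+ 2 + n2 ^+ 2 = (1 - n3) * (1 + n3) by have := nn; lra.
  by rewrite m2; field; lra.
exists m, (n1 / (2 * m)), (n2 / (2 * m)).
by split; rewrite -?addrA -?opprD ?e ?m2; field.
Qed.

Lemma sum3_sqr_eq0 (a b c : R) : a ^+ 2 + b ^+ 2 + c ^+ 2 = 0 ->
  [/\ a = 0, b = 0 & c = 0].
Proof.
move=> abc; have [a0 b0 c0] := And3 (sqr_ge0 a) (sqr_ge0 b) (sqr_ge0 c).
by split; apply/eqP; rewrite -sqrf_eq0 eq_le sqr_ge0 andbT; lra.
Qed.

Lemma cauchy3 (a1 a2 a3 b1 b2 b3 : R) :
  a1 * b1 + a2 * b2 + a3 * b3 <= Num.sqrt (a1 ^+ 2 + a2 ^+ 2 + a3 ^+ 2) *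
    Num.sqrt (b1 ^+ 2 + b2 ^+ 2 + b3 ^+ 2).
Proof.
rewrite -sqrtrM ?addr_ge0 ?sqr_ge0 //.
apply: (le_trans (ler_norm _)); rewrite -sqrtr_sqr ler_wsqrtr // -subr_ge0.
set X := (X in 0 <= X).
have -> : X = (a1 * b2 - a2 * b1) ^+ 2 + (a1 * b3 - a3 * b1) ^+ 2 +
  (a2 * b3 - a3 * b2) ^+ 2 by rewrite /X; ring.
by rewrite !addr_ge0 ?sqr_ge0.
Qed.

Lemma unit_vec3 (a1 a2 a3 : R) : exists n1 n2 n3,
  n1 ^+ 2 + n2 ^+ 2 + n3 ^+ 2 = 1 /\
  a1 * n1 + a2 * n2 + a3 * n3 = Num.sqrt (a1 ^+ 2 + a2 ^+ 2 + a3 ^+ 2).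
Proof.
set s := Num.sqrt _.
have s2 : s ^+ 2 = a1 ^+ 2 + a2 ^+ 2 + a3 ^+ 2.
  by rewrite sqr_sqrtr // !addr_ge0 ?sqr_ge0.
have [s0|s0] := eqVneq s 0.
  exists 1, 0, 0; split; first by ring.
  have : a1 ^+ 2 + a2 ^+ 2 + a3 ^+ 2 = 0 by rewrite -s2 s0 expr0n.
  move/eqP; rewrite !paddr_eq0 ?addr_ge0 ?sqr_ge0 // !sqrf_eq0 s0.
  by move=> /andP[/andP[/eqP-> _] _]; ring.
exists (a1 / s), (a2 / s), (a3 / s); split.
  have -> : (a1 / s) ^+ 2 + (a2 / s) ^+ 2 + (a3 / s) ^+ 2 =
    (a1 ^+ 2 + a2 ^+ 2 + a3 ^+ 2) / s ^+ 2 by field.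
  by rewrite -s2 divff // sqrf_eq0.
have -> : a1 * (a1 / s) + a2 * (a2 / s) + a3 * (a3 / s) =
  (a1 ^+ 2 + a2 ^+ 2 + a3 ^+ 2) / s by field.
by rewrite -s2 expr2 mulfK.
Qed.

End SpinGeometry.

(** * The support function of W(A) *)

Section BlockRange.
Variables (R : realType) (u v h0 h1 h2 h3 k0 k1 k2 k3 : R).
Implicit Types (c s : R) (y z : 'cV[R[i]]_2).

(* B = H + iK with H = h0 + h.sigma, K = k0 + k.sigma in the Pauli basis. *)
Definition pauli_mx : 'M[R[i]]_2 := \matrix_(i, j)
  if i == 0 then if j == 0 then (h0 + h3) +i* (k0 + k3)
                 else (h1 + k2) +i* (k1 - h2)
  else if j == 0 then (h1 - k2) +i* (h2 + k1) else (h0 - h3) +i* (k0 - k3).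

Local Notation B := pauli_mx.
Local Notation A := (blockA (u +i* v) B).

(* The traceless Pauli coordinates of B^* B. *)
Definition normal1 := 2 * (h0 * h1 + k0 * k1) - 2 * (h2 * k3 - h3 * k2).
Definition normal2 := 2 * (h0 * h2 + k0 * k2) - 2 * (h3 * k1 - h1 * k3).
Definition normal3 := 2 * (h0 * h3 + k0 * k3) - 2 * (h1 * k2 - h2 * k1).

(* [lam c s] is the largest eigenvalue of the Hermitian matrix
   c Re A + s Im A = [[a, C^*], [C, -a]] with a = cu + sv and C = cB + is; the
   eigenvalues of its square are those of a^2 + C^* C, which are
   meanT +- |c| sqrt gapG. *)
Definition meanT c s : R :=
  c ^+ 2 * (u ^+ 2 + h0 ^+ 2 + h1 ^+ 2 + h2 ^+ 2 + h3 ^+ 2 +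
            k0 ^+ 2 + k1 ^+ 2 + k2 ^+ 2 + k3 ^+ 2)
  + 2 * c * s * (u * v + k0) + s ^+ 2 * (1 + v ^+ 2).

Definition gapG c s : R := (c * normal1 + 2 * s * k1) ^+ 2 +
  (c * normal2 + 2 * s * k2) ^+ 2 + (c * normal3 + 2 * s * k3) ^+ 2.

Definition lam c s : R := Num.sqrt (meanT c s + `|c| * Num.sqrt (gapG c s)).

(* The matrix C above, as an operator. *)
Definition Cmap c s y : 'cV[R[i]]_2 := c%:C *: (B *m y) + (0 +i* s) *: y.

Lemma inner_conj y z : inner y z = conjc (inner z y).
Proof.
rewrite !inner2; case: (y 0 0) (y 1 0) (z 0 0) (z 1 0) => a b [a' b'] [c d] [c' d'].
by congr (_ +i* _) => /=; ring.
Qed.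

Lemma inner_adj (M : 'M[R[i]]_2) y z : inner (M^t* *m z) y = inner z (M *m y).
Proof. by rewrite /inner trmx_mul map_mxM mulmxA. Qed.

Lemma block_form y z :
  inner (A *m col_mx y z) (col_mx y z) =
  (u +i* v) * (inner y y - inner z z) +
  (2 * Re (inner (B *m y) z)) +i* (- 2 * Im (inner y z)).
Proof.
rewrite /blockA mul_block_col inner_col_mx !mulmxDl !mulNmx !mul1mx !mul_scalar_mx.
rewrite !innerDl inner_adj.
have neg M N : inner (- M) N = - inner M N by rewrite -scaleN1r innerZl mulN1r.
rewrite !neg !innerZl (inner_conj z (B *m y)) (inner_conj z y).
case: (inner (B *m y) z) (inner y z) => a b [a' b'].
rewrite (inner_self y) (inner_self z).
by congr (_ +i* _) => /=; ring.
Qed.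

Lemma dot_block c s y z :
  dot c s (inner (A *m col_mx y z) (col_mx y z)) =
  (c * u + s * v) * (Re (inner y y) - Re (inner z z)) +
  2 * Re (inner (Cmap c s y) z).
Proof.
rewrite block_form /Cmap innerDl !innerZl (inner_self y) (inner_self z) /dot.
by case: (inner (B *m y) z) (inner y z) => a b [a' b'] /=; ring.
Qed.

(** Half the trace of C^* C for the operator [Cmap c s]. *)
Definition meanC c s := c ^+ 2 * (h0 ^+ 2 + h1 ^+ 2 + h2 ^+ 2 + h3 ^+ 2 +
            k0 ^+ 2 + k1 ^+ 2 + k2 ^+ 2 + k3 ^+ 2) + 2 * c * s * k0 + s ^+ 2.

Lemma Cmap_norm c s y : Re (inner (Cmap c s y) (Cmap c s y)) =
  meanC c s * Re (inner y y) +
  c * ((c * normal1 + 2 * s * k1) * bloch1 y +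
       (c * normal2 + 2 * s * k2) * bloch2 y +
       (c * normal3 + 2 * s * k3) * bloch3 y).
Proof.
rewrite !inner2 /Cmap ![(_ + _ : 'cV[_]_2) _ _]mxE ![(_ *: _ : 'cV[_]_2) _ _]mxE.
rewrite !mulmx2 ![pauli_mx _ _]mxE /= /bloch1 /bloch2 /bloch3.
rewrite /meanC /normal1 /normal2 /normal3.
by case: (y 0 0) (y 1 0) => a b [a' b'] /=; ring.
Qed.

Lemma meanC_ge0 c s : 0 <= meanC c s.
Proof.
have -> : meanC c s = (c * h0) ^+ 2 + (c * h1) ^+ 2 + (c * h2) ^+ 2 +
  (c * h3) ^+ 2 + (c * k1) ^+ 2 + (c * k2) ^+ 2 + (c * k3) ^+ 2 +
  (c * k0 + s) ^+ 2 by rewrite /meanC; ring.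
by rewrite !addr_ge0 ?sqr_ge0.
Qed.

Lemma meanTE c s : meanT c s = (c * u + s * v) ^+ 2 + meanC c s.
Proof. by rewrite /meanT /meanC; ring. Qed.

(** The largest eigenvalue of C^* C, that is, the squared operator norm of C. *)
Definition topC c s := meanC c s + `|c| * Num.sqrt (gapG c s).

Lemma topC_ge0 c s : 0 <= topC c s.
Proof. by rewrite addr_ge0 ?meanC_ge0 // mulr_ge0 // sqrtr_ge0. Qed.

Lemma lamE c s :
  lam c s = Num.sqrt ((c * u + s * v) ^+ 2 + Num.sqrt (topC c s) ^+ 2).
Proof.
by rewrite /lam meanTE sqr_sqrtr ?topC_ge0 //; congr Num.sqrt; rewrite /topC; ring.
Qed.

Lemma gapGM c s : `|c| * Num.sqrt (gapG c s) =
  Num.sqrt ((c * (c * normal1 + 2 * s * k1)) ^+ 2 +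
  (c * (c * normal2 + 2 * s * k2)) ^+ 2 + (c * (c * normal3 + 2 * s * k3)) ^+ 2).
Proof.
by rewrite -sqrtr_sqr -sqrtrM ?sqr_ge0 //; congr Num.sqrt; rewrite /gapG; ring.
Qed.

(** Let [Y] and [Z] be the squared norms of the two halves of a unit vector. The form is at most a(Y
    - Z) + 2 S sqrt(YZ), where a = cu + sv and [S] is the norm of C, and (Y - Z, 2 sqrt(YZ)) is a
    unit vector because Y + Z = 1. *)
Lemma range_le_lam c s w : numerical_range A w -> dot c s w <= lam c s.
Proof.
move=> /numerical_rangeP [x + <-].
rewrite -(vsubmxK x); move: (usubmx x) (dsubmx x) => y z {x}.
rewrite inner_col_mx inner_self (inner_self z) -rmorphD => /complexI yz.
rewrite dot_block lamE.
set Y := Re (inner y y) in yz *; set Z := Re (inner z z) in yz *.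
have [Y0 Z0] : 0 <= Y /\ 0 <= Z by split; exact: Re_inner_ge0.
set S := Num.sqrt (topC c s).
have S0 : 0 <= S by exact: sqrtr_ge0.
have S2 : S ^+ 2 = topC c s by rewrite sqr_sqrtr ?topC_ge0.
have CY : Re (inner (Cmap c s y) (Cmap c s y)) <= S ^+ 2 * Y.
  rewrite Cmap_norm S2 /topC gapGM -/Y; set s3 := Num.sqrt _.
  have -> : (meanC c s + s3) * Y = meanC c s * Y + s3 * Y by ring.
  rewrite lerD2l /s3.
  have := cauchy3 (c * (c * normal1 + 2 * s * k1)) (c * (c * normal2 + 2 * s * k2))
   (c * (c * normal3 + 2 * s * k3)) (bloch1 y) (bloch2 y) (bloch3 y).
  rewrite bloch_norm sqrtr_sqr -/Y (ger0_norm Y0); apply: le_trans.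
  by rewrite le_eqVlt; apply/orP; left; apply/eqP; ring.
pose q := Num.sqrt (Y * Z).
have q0 : 0 <= q by exact: sqrtr_ge0.
have q2 : q ^+ 2 = Y * Z by rewrite sqr_sqrtr // mulr_ge0.
have rq : Re (inner (Cmap c s y) z) <= S * q.
  apply: (le_trans (ler_norm _)); rewrite -(@ler_pXn2r _ 2) ?nnegrE ?mulr_ge0 //.
  rewrite real_normK ?num_real // exprMn q2 mulrA.
  by apply: (le_trans (Re_inner_cauchy _ _)); rewrite ler_wpM2r.
have := @cauchy2 _ (Y - Z) (2 * q) (c * u + s * v) S.
have -> : (Y - Z) ^+ 2 + (2 * q) ^+ 2 = 1.
  by rewrite exprMn q2; have -> : Y = 1 - Z by [lra]; ring.
move=> /(_ (lexx _)); apply: le_trans.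
have -> : (Y - Z) * (c * u + s * v) + 2 * q * S =
  (c * u + s * v) * (Y - Z) + 2 * (S * q) by ring.
by rewrite lerD2l ler_pM2l.
Qed.

Lemma exists_unit y : exists z : 'cV[R[i]]_2, inner z z = 1 /\
   Re (inner y z) ^+ 2 = Re (inner y y) /\ 0 <= Re (inner y z).
Proof.
have [y0|y0] := eqVneq (Re (inner y y)) 0.
  have -> : y = 0 by apply: inner_eq0; rewrite inner_self y0.
  have [z [z1 _ _ _]] : exists z : 'cV[R[i]]_2, [/\ inner z z = 1,
      bloch1 z = 1, bloch2 z = 0 & bloch3 z = 0].
    by apply: bloch_surj; ring.
  exists z; split => //.
  by have e w : inner (0 : 'cV[R[i]]_2) w = 0 by [rewrite -(scale0r 0) innerZl mul0r];
    rewrite !e /=; split => //; ring.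
pose r := Num.sqrt (Re (inner y y)).
have r2 : r * r = Re (inner y y) by rewrite -expr2 sqr_sqrtr ?Re_inner_ge0.
have r0 : r != 0 by apply: contraNneq y0 => r0; rewrite -r2 r0 mul0r.
have e : inner y (r^-1%:C *: y) = r%:C.
  by rewrite innerZr inner_self conjc_real -rmorphM -r2 mulKf.
exists (r^-1%:C *: y); rewrite e innerZl e -rmorphM mulVf //=; split => //.
by rewrite -r2 expr2; split => //; exact: sqrtr_ge0.
Qed.

(** All inequalities behind [range_le_lam] become equalities: the Bloch vector of [y] is aligned
    with the traceless part of C^* C, [z] has the direction of C y, and the weights [m], [n] are the
    half-angle coordinates of the direction of [(c * u + s * v, S)]. *)
Lemma lam_attained c s : exists2 w, numerical_range A w & dot c s w = lam c s.
Proof.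
have [n1 [n2 [n3 [nn en]]]] := unit_vec3 (c * (c * normal1 + 2 * s * k1))
  (c * (c * normal2 + 2 * s * k2)) (c * (c * normal3 + 2 * s * k3)).
have [y [y1 b1 b2 b3]] := bloch_surj nn.
have [z [z1 [zz z0]]] := exists_unit (Cmap c s y).
set S := Num.sqrt (topC c s).
have zS : Re (inner (Cmap c s y) z) = S.
  rewrite /S -[LHS]ger0_norm // -sqrtr_sqr zz; congr Num.sqrt.
  rewrite Cmap_norm y1 b1 b2 b3 /topC gapGM -en /=; ring.
have [a [b [ab eab]]] := unit_vec (c * u + s * v) S.
have [m [n [mn ma nb]]] := half_angle ab.
exists (inner (A *m col_mx (m%:C *: y) (n%:C *: z)) (col_mx (m%:C *: y) (n%:C *: z))).
  apply/numerical_rangeP; exists (col_mx (m%:C *: y) (n%:C *: z)) => //.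
  rewrite inner_col_mx !innerZl !innerZr y1 z1 !conjc_real !mulr1 -!rmorphM -rmorphD.
  by rewrite -!expr2 mn.
rewrite lamE -eab dot_block.
have -> : Cmap c s (m%:C *: y) = m%:C *: Cmap c s y.
  by rewrite /Cmap -scalemxAr scalerDr !scalerA (mulrC _ m%:C) (mulrC (_ +i* _) m%:C).
rewrite !innerZl !innerZr y1 z1 !conjc_real !mulr1 -!rmorphM -ma -nb.
move: zS; case: (inner (Cmap c s y) z) => X Z /= ->; ring.
Qed.

(** Since C is the scalar [i] at [(c, s) = (0, 1)], the vectors [(m y, i n y)] include top
    eigenvectors of Im A. The free Bloch vector then moves the point along a horizontal edge of the
    range. *)
Lemma vertical_point n1 n2 n3 a b :
  n1 ^+ 2 + n2 ^+ 2 + n3 ^+ 2 = 1 -> a ^+ 2 + b ^+ 2 = 1 ->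
  numerical_range A ((u * a + b * (k0 + (k1 * n1 + k2 * n2 + k3 * n3)))
                     +i* (v * a + b)).
Proof.
move=> nn ab; have [y [y1 b1 b2 b3]] := bloch_surj nn.
have [m [n [mn ma nb]]] := half_angle ab.
apply/numerical_rangeP; exists (col_mx (m%:C *: y) ((0 +i* n) *: y)).
  rewrite inner_col_mx !innerZl !innerZr y1 !mulr1.
  by congr (_ +i* _) => /=; rewrite -?mn; ring.
rewrite block_form -scalemxAr !innerZl !innerZr y1 !mulr1.
have e : Im (inner (B *m y) y) = k0 + (k1 * n1 + k2 * n2 + k3 * n3).
  have : Re (inner y y) = 1 by rewrite y1.
  rewrite -b1 -b2 -b3 /bloch1 /bloch2 /bloch3 => e.
  rewrite -[k0 in RHS]mulr1 -e !inner2 !mulmx2 ![pauli_mx _ _]mxE /=.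
  by case: (y 0 0) (y 1 0) => ? ? [? ?] /=; ring.
move: e; case: (inner (B *m y) y) => X Z /= <-; rewrite -ma -nb.
by congr (_ +i* _) => /=; ring.
Qed.

End BlockRange.

(** * Sufficiency *)

Section Sufficiency.
Variables (R : realType) (u v h0 h1 h2 h3 k0 k1 k2 k3 t m n r : R).
Implicit Types a b c s : R.

Local Notation A := (blockA (u +i* v) (pauli_mx h0 h1 h2 h3 k0 k1 k2 k3)).
Local Notation meanT := (meanT u v h0 h1 h2 h3 k0 k1 k2 k3).
Local Notation gapG := (gapG h0 h1 h2 h3 k0 k1 k2 k3).
Local Notation lam := (lam u v h0 h1 h2 h3 k0 k1 k2 k3).

Hypotheses (t0 : 0 < t) (m0 : 0 < m) (r0 : 0 < r).
Hypothesis meanT_eq : forall c s,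
  meanT c s = (t * c) ^+ 2 + ((m * c) ^+ 2 + (n * c + r * s) ^+ 2).
Hypothesis gapG_eq : forall c s,
  gapG c s = (2 * t) ^+ 2 * ((m * c) ^+ 2 + (n * c + r * s) ^+ 2).

Let mn : m != 0. Proof. by rewrite gt_eqF. Qed.
Let rn : r != 0. Proof. by rewrite gt_eqF. Qed.

(** Under the two identities the radicand is a perfect square. The result is the support function of
    the sum of the segment [[-t, t]] and a filled ellipse, called the stadium below. *)
Lemma lam_split c s :
  lam c s = t * `|c| + Num.sqrt ((m * c) ^+ 2 + (n * c + r * s) ^+ 2).
Proof.
have t2 : 0 <= 2 * t by rewrite mulr_ge0 // ltW.
rewrite /lam meanT_eq gapG_eq sqrtrM ?sqr_ge0 // sqrtr_sqr (ger0_norm t2).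
set q := (m * c) ^+ 2 + _.
have q0 : 0 <= q by rewrite addr_ge0 ?sqr_ge0.
rewrite -[X in (t * c) ^+ 2 + X](sqr_sqrtr q0) exprMn -(real_normK (num_real c)).
set x := `|c|; set y := Num.sqrt q.
have -> : t ^+ 2 * x ^+ 2 + y ^+ 2 + x * (2 * t * y) = (t * x + y) ^+ 2 by ring.
have xy : 0 <= t * x + y.
  by apply: addr_ge0; [apply: mulr_ge0; [exact: ltW|exact: normr_ge0]|exact: sqrtr_ge0].
by rewrite sqrtr_sqr ger0_norm.
Qed.

Lemma range_stadium w : numerical_range A w -> exists tau a b,
  [/\ `|tau| <= t, a ^+ 2 + b ^+ 2 <= 1 &
      w = (tau + (m * a + n * b)) +i* (r * b)].
Proof.
move=> /range_le_lam H.
pose b := Im w / r; pose X := Re w - n * b.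
have wE : w = (X + n * b) +i* (r * b).
  by rewrite [LHS]complex_eta; congr (_ +i* _); rewrite /X /b; field.
(* A linear change of coordinates turns the ellipse into the unit disk and the half-length of the
   segment into [t / m]. *)
have supp_le c' s' : c' * (X / m) + s' * b <= t / m * `|c'| + Num.sqrt (c' ^+ 2 + s' ^+ 2).
  have := H (c' / m) ((s' - n * (c' / m)) / r); rewrite lam_split /dot wE /=.
  have -> : m * (c' / m) = c' by field.
  have -> : n * (c' / m) + r * ((s' - n * (c' / m)) / r) = s' by field; rewrite mn rn.
  rewrite normrM normfV (gtr0_norm m0).
  have -> : t * (`|c'| / m) = t / m * `|c'| by field.
  apply: le_trans; rewrite le_eqVlt; apply/orP; left; apply/eqP.
  by field; rewrite mn rn.
have b1 : b ^+ 2 <= 1.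
  have := supp_le 0 b; rewrite normr0 mul0r mulr0 !add0r expr0n /= add0r sqrtr_sqr.
  rewrite -expr2 -(real_normK (num_real b)).
  have := normr_ge0 b; nra.
have [tX|tX] := lerP `|X| t.
  by exists X, 0, b; split=> //; rewrite ?expr0n ?add0r // mulr0 add0r.
(* The horizontal overshoot past the nearer end of the segment. Testing the direction [(e * d, b)]
   from that end to the point bounds their distance by 1. *)
pose d := `|X| / m - t / m.
have d0 : 0 < d by rewrite /d -mulrBl divr_gt0 // subr_gt0.
pose e := Num.sg X.
have Xn0 : X != 0 by rewrite -normr_gt0 (lt_trans t0 tX).
have e2 : e ^+ 2 = 1 by rewrite sqr_sg Xn0.
have eX : e * `|X| = X by rewrite -numEsg.
have Xe : e * X = `|X| by rewrite -normrEsg.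
have e1 : `|e| = 1 by rewrite normr_sg Xn0.
have db : d ^+ 2 + b ^+ 2 <= 1.
  have := supp_le (e * d) b; rewrite normrM e1 mul1r (gtr0_norm d0) exprMn e2 mul1r.
  have -> : e * d * (X / m) = (e * X) / m * d by field.
  rewrite Xe; set S := Num.sqrt _ => h.
  have S2 : S ^+ 2 = d ^+ 2 + b ^+ 2 by rewrite sqr_sqrtr // addr_ge0 ?sqr_ge0.
  have S0 : 0 <= S by exact: sqrtr_ge0.
  have : S ^+ 2 <= S.
    rewrite S2 -(lerD2l (t / m * d)); apply: le_trans h.
    by rewrite le_eqVlt; apply/orP; left; apply/eqP; rewrite /d; ring.
  rewrite -S2; nra.
exists (e * t), (e * d), b; split.
- by rewrite normrM e1 mul1r gtr0_norm.
- by rewrite exprMn e2 mul1r.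
- rewrite {1}wE; congr (_ +i* _).
  have -> : e * t + (m * (e * d) + n * b) = e * `|X| + n * b.
    by rewrite /d; field.
  by rewrite eX.
Qed.

(* For a > 0 the point is exposed, hence attained by an eigenvector for its normal
   direction; for a = 0 it is a corner of a horizontal edge of the boundary. *)
Lemma stadium_boundary e a b : e ^+ 2 = 1 -> 0 <= a -> a ^+ 2 + b ^+ 2 = 1 ->
  numerical_range A ((e * (t + m * a) + n * b) +i* (r * b)).
Proof.
move=> e2 a0 ab.
have [az|an] := eqVneq a 0.
  have b2 : b ^+ 2 = 1 by rewrite -ab az expr0n add0r.
  have [n1 [n2 [n3 [nn en]]]] := unit_vec3 k1 k2 k3.
  have r2 : r ^+ 2 = 1 + v ^+ 2.
    by have := meanT_eq 0 1; rewrite /meanT => h; lra.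
  have nr : n * r = u * v + k0.
    have := meanT_eq 1 1; have := meanT_eq 1 (-1); rewrite /meanT; lra.
  have kt : Num.sqrt (k1 ^+ 2 + k2 ^+ 2 + k3 ^+ 2) = t * r.
    have -> : k1 ^+ 2 + k2 ^+ 2 + k3 ^+ 2 = (t * r) ^+ 2.
      by have := gapG_eq 0 1; rewrite /gapG => h; lra.
    by rewrite sqrtr_sqr ger0_norm // mulr_ge0 // ltW.
  have eb2 : (b * e) ^+ 2 = 1 by rewrite exprMn b2 e2 mulr1.
  (* The sign [b] selects the upper or lower edge through [(v, 1) / r], and a Bloch vector parallel
     to [k] reaches the end of that edge on the side [e]. *)
  have := @vertical_point R u v h0 h1 h2 h3 k0 k1 k2 k3 (b * e * n1) (b * e * n2)
    (b * e * n3) (b * v / r) (b / r).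
  have -> : (b * e * n1) ^+ 2 + (b * e * n2) ^+ 2 + (b * e * n3) ^+ 2 =
    (b * e) ^+ 2 * (n1 ^+ 2 + n2 ^+ 2 + n3 ^+ 2) by ring.
  rewrite eb2 nn mul1r => /(_ erefl).
  have -> : (b * v / r) ^+ 2 + (b / r) ^+ 2 = b ^+ 2 * (1 + v ^+ 2) / r ^+ 2 by field.
  rewrite b2 mul1r -r2 divff ?sqrf_eq0 // => /(_ erefl).
  have -> : v * (b * v / r) + b / r = b * (1 + v ^+ 2) / r by field.
  have -> : u * (b * v / r) + b / r * (k0 + (k1 * (b * e * n1) +
      k2 * (b * e * n2) + k3 * (b * e * n3)))
    = (b * (u * v + k0) + b ^+ 2 * (e * (k1 * n1 + k2 * n2 + k3 * n3))) / r by field.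
  rewrite en kt b2 -nr -r2 az mulr0 addr0.
  have -> : b * r ^+ 2 / r = r * b by field.
  by have -> : (b * (n * r) + 1 * (e * (t * r))) / r = e * t + n * b by field.
have ap : 0 < a by rewrite lt_neqAle eq_sym an.
have [w Ww] := @lam_attained R u v h0 h1 h2 h3 k0 k1 k2 k3 (e * a / m) ((b - n * (e * a / m)) / r).
have [tau [a' [b' [taut ab' wE]]]] := range_stadium Ww.
rewrite lam_split /dot wE /=.
have -> : m * (e * a / m) = e * a by field.
have -> : n * (e * a / m) + r * ((b - n * (e * a / m)) / r) = b by field; rewrite mn rn.
have e1 : `|e| = 1 by apply/eqP; rewrite -sqr_norm_eq1 e2.
rewrite normrM normfV (gtr0_norm m0) normrM e1 mul1r (gtr0_norm ap) exprMn e2 mul1r ab sqrtr1.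
have -> : e * a / m * (tau + (m * a' + n * b')) + (b - n * (e * a / m)) / r * (r * b')
  = e * tau * (a / m) + (e * a * a' + b * b') by field; rewrite mn rn.
have am : 0 < a / m by rewrite divr_gt0.
have l1 : e * tau * (a / m) <= t * (a / m).
  by rewrite ler_pM2r // (le_trans (ler_norm _)) // normrM e1 mul1r.
have eab : (e * a) ^+ 2 + b ^+ 2 <= 1 by rewrite exprMn e2 mul1r ab.
have l2 : e * a * a' + b * b' <= 1.
  have := sqr_ge0 (e * a - a'); have := sqr_ge0 (b - b'); lra.
(* The support value is the sum of the bounds [l1] and [l2], so both are equalities; the second
   forces [(a', b') = (e * a, b)]. *)
move=> E.
have E1 : e * tau = t.
  apply: (@mulIf _ (a / m)); first by rewrite gt_eqF.
  lra.
have E2 : e * a * a' + b * b' = 1 by lra.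
have /eqP : (e * a - a') ^+ 2 + (b - b') ^+ 2 = 0.
  apply/eqP; rewrite eq_le addr_ge0 ?sqr_ge0 // andbT; lra.
rewrite paddr_eq0 ?sqr_ge0 // !sqrf_eq0 !subr_eq0 => /andP[/eqP ea /eqP eb].
suff -> : (e * (t + m * a) + n * b) +i* (r * b) = w by [].
rewrite wE -ea -eb -E1; congr (_ +i* _).
have -> : e * (e * tau + m * a) = e ^+ 2 * tau + m * (e * a) by ring.
by rewrite e2; ring.
Qed.

(** Each point of the stadium lies on a horizontal segment between the boundary points with [e = -1]
    and [e = 1] at its height. *)
Lemma stadium_sub S : @convex_set R (Rcomplex R) S ->
  (forall e a b, e ^+ 2 = 1 -> 0 <= a -> a ^+ 2 + b ^+ 2 = 1 ->
     S ((e * (t + m * a) + n * b) +i* (r * b))) ->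
  forall tau a b, `|tau| <= t -> a ^+ 2 + b ^+ 2 <= 1 ->
    S ((tau + (m * a + n * b)) +i* (r * b)).
Proof.
move=> cS HS tau a b; rewrite ler_norml => /andP[t1 t2] ab.
pose d := Num.sqrt (1 - b ^+ 2).
have d2 : d ^+ 2 = 1 - b ^+ 2.
  by rewrite sqr_sqrtr // subr_ge0 (le_trans _ ab) // lerDr sqr_ge0.
have d0 : 0 <= d by exact: sqrtr_ge0.
have [l1 l2] : - d <= a /\ a <= d.
  have : `|a| <= d.
    by rewrite -(@ler_pXn2r _ 2) ?nnegrE // d2 real_normK ?num_real // lerBrDr.
  by rewrite ler_norml => /andP[].
have db : d ^+ 2 + b ^+ 2 = 1 by rewrite d2 subrK.
apply: (convex_hsegment cS (HS (-1) d b _ d0 db) (HS 1 d b _ d0 db)).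
- by rewrite sqrrN expr1n.
- by rewrite expr1n.
- have : m * a <= m * d by rewrite ler_pM2l.
  have : m * - d <= m * a by rewrite ler_pM2l.
  by move=> *; apply/andP; split; lra.
Qed.

Lemma bielliptical_range : bielliptical (numerical_range A).
Proof.
exists (ell t%:C m n r), (ell (- t)%:C m n r), t%:C, (- t)%:C; split.
- by split; apply/is_ellipseP; exists m, n, r.
- by move=> /complexI h; have : t <= 0 by [lra]; rewrite leNgt t0.
(* In the direction [(1, 0)] the right ellipse reaches [2 * t] further than the left one; the next
   case is the mirror image. *)
- have [z Ez dz] := @ell_supp_attained R t%:C m n r 1 0.
  move=> /(_ _ Ez) /(@convex_hull_halfplane _ _ 1 0 (supp (- t)%:C m n r 1 0)).
  rewrite dz /supp /dot /= => H; have {}H := H (fun z => @ell_le_supp _ _ _ _ _ z 1 0);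
  by have : t <= 0 by [lra]; rewrite leNgt t0.
- have [z Ez dz] := @ell_supp_attained R (- t)%:C m n r (-1) 0.
  move=> /(_ _ Ez) /(@convex_hull_halfplane _ _ (-1) 0 (supp t%:C m n r (-1) 0)).
  rewrite dz /supp /dot /= => H; have {}H := H (fun z => @ell_le_supp _ _ _ _ _ z (-1) 0);
  by have : t <= 0 by [lra]; rewrite leNgt t0.
- apply/seteqP; split=> [w /range_stadium [tau [a [b [ht ab ->]]]]|].
    apply: stadium_sub => //; first exact: convex_hull_convex.
    move=> e {}a {}b e2 a0 {}ab; apply: sub_convex_hull.
    have : (e - 1) * (e + 1) = 0 by rewrite -subr_sqr e2 expr1n subrr.
    move/eqP; rewrite mulf_eq0 subr_eq0 addr_eq0 => /orP[] /eqP->.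
      by left; exists a, b; split => //; congr (_ +i* _) => /=; ring.
    by right; exists (- a), b; split; rewrite ?sqrrN //; congr (_ +i* _) => /=; ring.
  apply: smallest_sub; first exact: numerical_range_convex.
  have sub tau : `|tau| <= t -> ell tau%:C m n r `<=` numerical_range A.
    move=> ht z [a [b [ab ->]]] /=; rewrite add0r.
    apply: stadium_sub; [exact: numerical_range_convex|exact: stadium_boundary|by []|].
    by rewrite ab.
  by move=> z []; apply: sub; rewrite ?normrN gtr0_norm.
Qed.

End Sufficiency.

(** * Necessity *)

Section PolynomialIdentities.
Variable R : realType.
Implicit Types (p q Y Z : {poly R}) (m n r x d : R).

Lemma poly_itv_eq0 p x d : 0 < d ->
  (forall e, 0 <= e -> e <= d -> p.[x + e] = 0) -> p = 0.
Proof.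
move=> d0 H.
pose rs := [seq x + d / k.+1%:R | k <- iota 0 (size p)].
apply: (@roots_geq_poly_eq0 _ _ rs).
- apply/allP => _ /mapP [k _ ->]; apply/eqP; apply: H.
    by rewrite divr_ge0 // ltW.
  by rewrite ler_pdivrMr //; apply: ler_peMr; [exact: ltW|rewrite ler1n].
- rewrite map_inj_uniq ?iota_uniq // => i j /addrI.
  by move/(mulfI (lt0r_neq0 d0))/invr_inj/eqP; rewrite eqr_nat => /eqP [].
- by rewrite size_map size_iota.
Qed.

(* A conjugate root of [q] would have even multiplicity in [Y ^+ 2] and odd
   multiplicity in [q * Z ^+ 2]. *)
Lemma sqr_eq_posdef_mul m n r Y Z : 0 < m -> 0 < r ->
  Y ^+ 2 = ((m ^+ 2)%:P + (n%:P + r *: 'X) ^+ 2) * Z ^+ 2 -> Z = 0.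
Proof.
move=> m0 r0 E; apply/eqP; apply/negPn/negP => Zn0.
have [mn rn] : m != 0 /\ r != 0 by rewrite !gt_eqF.
set q := _ + _ in E.
have qn0 : q != 0.
  apply/negP => /eqP /(congr1 (fun p => p.[0])).
  rewrite /q !hornerE => h.
  have : 0 < m ^+ 2 by rewrite exprn_gt0.
  have := sqr_ge0 n; nra.
have Yn0 : Y != 0 by rewrite -sqrf_eq0 E mulf_neq0 // sqrf_eq0.
pose C := map_poly (real_complex R).
have CE : C Y ^+ 2 = C q * C Z ^+ 2 by rewrite -!rmorphXn -rmorphM -E.
have Cn0 p : p != 0 -> C p != 0 by rewrite /C map_poly_eq0.
(* The roots of m^2 + (n + rX)^2; they are distinct because [m] is nonzero. *)
pose z1 : R[i] := (- n / r) +i* (m / r); pose z2 : R[i] := (- n / r) +i* - (m / r).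
have qE : C q = ((r ^+ 2)%:C%:P * ('X - z2%:P)) * ('X - z1%:P).
  have e1 : z1 + z2 = (- 2 * n / r)%:C by congr (_ +i* _) => /=; field.
  have e2 : z1 * z2 = ((m ^+ 2 + n ^+ 2) / r ^+ 2)%:C.
    by congr (_ +i* _) => /=; field.
  have -> : (r ^+ 2)%:C%:P * ('X - z2%:P) * ('X - z1%:P) =
    (r ^+ 2)%:C%:P * 'X ^+ 2 - ((r ^+ 2)%:C * (z1 + z2))%:P * 'X +
    ((r ^+ 2)%:C * (z1 * z2))%:P by rewrite !polyCM polyCD; ring.
  rewrite e1 e2 -!rmorphM.
  have -> : r ^+ 2 * (- 2 * n / r) = - (2 * n * r) by field.
  have -> : r ^+ 2 * ((m ^+ 2 + n ^+ 2) / r ^+ 2) = m ^+ 2 + n ^+ 2 by field.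
  rewrite /C /q -mul_polyC rmorphD rmorphXn rmorphD rmorphM /= !map_polyC map_polyX /=.
  by rewrite !(expr2, rmorphN, rmorphD, rmorphM, rmorph_nat) /=; ring.
have mq : mup z1 (C q) = 1%N.
  rewrite qE mupMr ?(mup_XsubCX 1) ?eqxx //.
  rewrite /root !hornerE mulf_neq0 //; first by rewrite fmorph_eq0 expf_neq0.
  rewrite subr_eq0 eq_complex /= negb_and orbC -subr_eq0 opprK.
  by rewrite gt_eqF // addr_gt0 // divr_gt0.
have := congr1 (mup z1) CE.
rewrite !expr2 !mupM ?mulf_neq0 ?Cn0 // mq => /(congr1 odd).
by rewrite !oddD !addbb.
Qed.

End PolynomialIdentities.

(** * Directions in which one ellipse dominates another *)

Section SupportComparison.
Variable R : realType.
Implicit Types (c : R[i]) (m n r x y a d e : R).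

Lemma supp_homog c m n r a x y : 0 <= a ->
  supp c m n r (a * x) (a * y) = a * supp c m n r x y.
Proof.
move=> a0; rewrite /supp /dot.
have -> : (m * (a * x)) ^+ 2 + (n * (a * x) + r * (a * y)) ^+ 2 =
  a ^+ 2 * ((m * x) ^+ 2 + (n * x + r * y) ^+ 2) by ring.
rewrite sqrtrM ?sqr_ge0 // sqrtr_sqr ger0_norm //; ring.
Qed.

Lemma supp_subadd c m n r x y x' y' :
  supp c m n r (x + x') (y + y') <= supp c m n r x y + supp c m n r x' y'.
Proof.
have [z Ez <-] := ell_supp_attained c m n r (x + x') (y + y').
have := ell_le_supp x y Ez; have := ell_le_supp x' y' Ez; rewrite /dot; lra.
Qed.

(** By sublinearity, a displacement by [e * (x', y')] lowers the gap [g] by less than [e * K] when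
    [e > 0]. *)
Lemma supp_lt_stable c1 m1 n1 r1 c2 m2 n2 r2 x y x' y' :
  supp c1 m1 n1 r1 x y < supp c2 m2 n2 r2 x y ->
  exists2 d, 0 < d & forall e, 0 <= e -> e <= d ->
    supp c1 m1 n1 r1 (x + e * x') (y + e * y') <
    supp c2 m2 n2 r2 (x + e * x') (y + e * y').
Proof.
move=> lt12.
set g := supp c2 m2 n2 r2 x y - supp c1 m1 n1 r1 x y.
pose K := `|supp c1 m1 n1 r1 x' y' + supp c2 m2 n2 r2 (- x') (- y')| + 1.
have K0 : 0 < K by rewrite ltr_wpDl.
have g0 : 0 < g by rewrite subr_gt0.
exists (g / K); first by rewrite divr_gt0.
move=> e e0; rewrite ler_pdivlMr // => eK.
have [->|en0] := eqVneq e 0; first by rewrite !mul0r !addr0.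
have ep : 0 < e by rewrite lt_neqAle eq_sym en0.
have := supp_subadd c1 m1 n1 r1 x y (e * x') (e * y').
have := supp_subadd c2 m2 n2 r2 (x + e * x') (y + e * y') (e * - x') (e * - y').
have -> : x + e * x' + e * - x' = x by ring.
have -> : y + e * y' + e * - y' = y by ring.
rewrite !(supp_homog _ _ _ _ _ _ e0) /g.
have : e * (supp c1 m1 n1 r1 x' y' + supp c2 m2 n2 r2 (- x') (- y')) < e * K.
  by rewrite ltr_pM2l // ltr_pwDr // ler_norm.
rewrite /g in eK; lra.
Qed.

(** Homogeneity normalizes the first coordinate of the direction to a sign [b], after a small
    perturbation if it is zero. One real variable remains, as needed for polynomial identities. *)
Lemma supp_lt_interval c1 m1 n1 r1 c2 m2 n2 r2 x y :
  supp c1 m1 n1 r1 x y < supp c2 m2 n2 r2 x y ->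
  exists b y0 d, [/\ b ^+ 2 = 1, 0 < d & forall e, 0 <= e -> e <= d ->
    supp c1 m1 n1 r1 b (b * (y0 + e)) < supp c2 m2 n2 r2 b (b * (y0 + e))].
Proof.
wlog xn0 : x y / x != 0.
  move=> W lt12; have [x0|] := eqVneq x 0; last by move=> h; exact: W lt12.
  have [d d0 H] := supp_lt_stable 1 0 lt12.
  apply: (W _ _ _ (H d (ltW d0) (lexx d))).
  by rewrite x0 add0r mulr1 gt_eqF.
move=> lt12; pose b := Num.sg x.
have b2 : b ^+ 2 = 1 by rewrite sqr_sg xn0.
have n0 : 0 < `|x| by rewrite normr_gt0.
have xE : x = `|x| * b by rewrite mulrC -numEsg.
have yE : y = `|x| * (b * (y / x)).
  rewrite mulrA -xE; by field.
have E c m n r : supp c m n r x y = `|x| * supp c m n r b (b * (y / x)).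
  by rewrite -supp_homog ?ltW // -xE -yE.
move: lt12; rewrite !E ltr_pM2l // => lt12.
have [d d0 H] := supp_lt_stable 0 b lt12.
exists b, (y / x), d; split => // e e0 ed; have := H e e0 ed.
by rewrite mulr0 addr0 (mulrC e) -mulrDr.
Qed.

(** The centers differ, so one is nonzero. Its ellipse is not inside the hull of the other, hence
    strictly dominates it in some direction and then on an interval of directions, where it alone
    determines the support function of the hull. *)
Lemma bielliptical_supp (W : set R[i]) (L : R -> R -> R) :
  (forall x y w, W w -> dot x y w <= L x y) ->
  (forall x y, exists2 w, W w & dot x y w = L x y) ->
  bielliptical W -> exists c m n r b y0 d,
    [/\ [/\ c != 0, 0 < m & 0 < r], b ^+ 2 = 1, 0 < d &
    forall e, 0 <= e -> e <= d ->
      L b (b * (y0 + e)) = supp c m n r b (b * (y0 + e))].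
Proof.
move=> Wle Watt.
suff key c1 m1 n1 r1 c2 m2 n2 r2 : 0 < m1 -> 0 < r1 -> 0 < m2 -> 0 < r2 ->
    ~ (ell c2 m2 n2 r2 `<=` convex_hull (ell c1 m1 n1 r1)) -> c2 != 0 ->
    W = convex_hull (ell c1 m1 n1 r1 `|` ell c2 m2 n2 r2) ->
    exists c m n r b y0 d,
    [/\ [/\ c != 0, 0 < m & 0 < r], b ^+ 2 = 1, 0 < d &
    forall e, 0 <= e -> e <= d ->
      L b (b * (y0 + e)) = supp c m n r b (b * (y0 + e))].
  move=> [E1 [E2 [c1 [c2 [[/is_ellipseP [m1 [n1 [r1 [m10 r10 ->]]]]
    /is_ellipseP [m2 [n2 [r2 [m20 r20 ->]]]]] c12 s12 s21 WE]]]]].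
  have [c2_0|c2n0] := eqVneq c2 0; last exact: (key c1 m1 n1 r1 c2 m2 n2 r2).
  apply: (key c2 m2 n2 r2 c1 m1 n1 r1) => //; last by rewrite setUC.
  by apply/eqP => c1_0; apply: c12; rewrite c1_0 c2_0.
move=> m10 r10 m20 r20 s21 c20 WE.
have [x [y lt12]] : exists x y, supp c1 m1 n1 r1 x y < supp c2 m2 n2 r2 x y.
  apply: contrapT => H; apply: s21 => z Ez; apply: supp_le_hull => // x y.
  apply: (le_trans (ell_le_supp x y Ez)); rewrite leNgt; apply/negP => h.
  by apply: H; exists x, y.
have [b [y0 [d [b2 d0 H]]]] := supp_lt_interval lt12.
exists c2, m2, n2, r2, b, y0, d; split => // e e0 ed.
apply/le_anti/andP; split.
  have [w + <-] := Watt b (b * (y0 + e)).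
  rewrite WE; apply: convex_hull_halfplane => z [] Ez; last exact: ell_le_supp.
  by apply: (le_trans (ell_le_supp _ _ Ez)); rewrite ltW // H.
have [z Ez <-] := ell_supp_attained c2 m2 n2 r2 b (b * (y0 + e)).
by apply: Wle; rewrite WE; apply: sub_convex_hull; right.
Qed.

End SupportComparison.

Section Necessity.
Variables (R : realType) (u v h0 h1 h2 h3 k0 k1 k2 k3 : R).

Local Notation A := (blockA (u +i* v) (pauli_mx h0 h1 h2 h3 k0 k1 k2 k3)).
Local Notation meanT := (meanT u v h0 h1 h2 h3 k0 k1 k2 k3).
Local Notation gapG := (gapG h0 h1 h2 h3 k0 k1 k2 k3).
Local Notation lam := (lam u v h0 h1 h2 h3 k0 k1 k2 k3).

Lemma bielliptical_range_split : bielliptical (numerical_range A) ->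
  exists t m n r, [/\ 0 < t, 0 < m & 0 < r] /\ forall c s,
    meanT c s = (t * c) ^+ 2 + ((m * c) ^+ 2 + (n * c + r * s) ^+ 2) /\
    gapG c s = (2 * t) ^+ 2 * ((m * c) ^+ 2 + (n * c + r * s) ^+ 2).
Proof.
move=> /(bielliptical_supp (fun x y w => @range_le_lam _ _ _ _ _ _ _ _ _ _ _ x y w)).
move=> /(_ (lam_attained _ _ _ _ _ _ _ _ _ _)).
move=> [c [m [n [r [b [y0 [d [[c0 m0 r0] b2 d0 H]]]]]]]].
(* Along the directions b(1, x), the sign [b] drops out of the quadratic forms and is absorbed in
   the linear part [f]. *)
pose x1 := b * Re c; pose x2 := b * Im c.
pose f : {poly R} := x1%:P + x2 *: 'X.
pose q : {poly R} := (m ^+ 2)%:P + (n%:P + r *: 'X) ^+ 2.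
pose tau : {poly R} := (meanT 1 0)%:P + (2 * (u * v + k0)) *: 'X
  + (1 + v ^+ 2) *: 'X ^+ 2.
pose lin p k : {poly R} := p%:P + (2 * k) *: 'X.
pose g := lin (normal1 h0 h1 h2 h3 k0 k1 k2 k3) k1 ^+ 2 +
  lin (normal2 h0 h1 h2 h3 k0 k1 k2 k3) k2 ^+ 2 +
  lin (normal3 h0 h1 h2 h3 k0 k1 k2 k3) k3 ^+ 2.
have fE x : f.[x] = x1 + x2 * x by rewrite /f !hornerE.
have qE x : q.[x] = m ^+ 2 + (n + r * x) ^+ 2 by rewrite /q !hornerE.
have tauE x : tau.[x] = meanT 1 x.
  by rewrite /tau !hornerE /meanT /=; ring.
have gE x : g.[x] = gapG 1 x.
  by rewrite /g /lin !hornerE /gapG /=; ring.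
have qdef : q = (m ^+ 2)%:P + (n%:P + r *: 'X) ^+ 2 by [].
clearbody f q tau g.
have bn0 : b != 0 by rewrite -sqrf_eq0 b2 oner_neq0.
have fn0 : f != 0.
  apply: contra c0 => /eqP fz.
  have x10 : x1 = 0 by have := fE 0; rewrite fz horner0 mulr0 addr0.
  have x20 : x2 = 0 by have := fE 1; rewrite fz horner0 x10 mulr1 add0r.
  move: x10 x20 => /eqP + /eqP; rewrite !mulf_eq0 (negPf bn0) /= => R0 I0.
  by rewrite eq_complex R0.
have b1 : `|b| = 1 by apply/eqP; rewrite -sqr_norm_eq1 b2.
pose X := f ^+ 2 + q - tau.
(* Squaring [lam] gives sqrt g = X + 2 f sqrt q on the interval; squaring again gives g - X^2 - 4
   f^2 q = 4 X f sqrt q. *)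
have YZ : (g - X ^+ 2 - 4 * f ^+ 2 * q) ^+ 2 = q * (4 * X * f) ^+ 2.
  apply/eqP; rewrite -subr_eq0; apply/eqP.
  apply: (@poly_itv_eq0 _ _ y0 d d0) => e e0 ed; set x := y0 + e.
  have := H e e0 ed; rewrite -/x /lam /supp.
  have -> : dot b (b * x) c = f.[x] by rewrite fE /dot /x1 /x2; ring.
  have -> : (m * b) ^+ 2 + (n * b + r * (b * x)) ^+ 2 = q.[x].
    by rewrite qE -[RHS]mul1r -b2; ring.
  have -> : meanT b (b * x) = tau.[x].
    have -> : meanT b (b * x) = b ^+ 2 * meanT 1 x by rewrite /meanT; ring.
    by rewrite tauE b2 mul1r.
  have -> : gapG b (b * x) = g.[x].
    have -> : gapG b (b * x) = b ^+ 2 * gapG 1 x by rewrite /gapG; ring.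
    by rewrite gE b2 mul1r.
  rewrite b1 mul1r.
  have tau0 : 0 <= tau.[x].
    by rewrite tauE meanTE addr_ge0 ?sqr_ge0 // meanC_ge0.
  have q0 : 0 <= q.[x] by rewrite qE addr_ge0 ?sqr_ge0.
  have g0 : 0 <= g.[x] by rewrite gE /gapG !addr_ge0 ?sqr_ge0.
  have [Q2 G2] := (sqr_sqrtr q0, sqr_sqrtr g0).
  set Q := Num.sqrt q.[x] in Q2 *; set G := Num.sqrt g.[x] in G2 *.
  have G0 : 0 <= G by exact: sqrtr_ge0.
  move=> /(congr1 (fun z => z ^+ 2)); rewrite sqr_sqrtr ?addr_ge0 // => E.
  have GE : G = (f.[x] + Q) ^+ 2 - tau.[x] by rewrite -E addrC addKr.
  rewrite /X !(hornerE, horner_exp) /= -G2 -Q2 GE.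
  set F := f.[x]; set T := tau.[x]; ring.
have Z0 : 4 * X * f = 0.
  by apply: (@sqr_eq_posdef_mul _ m n r (g - X ^+ 2 - 4 * f ^+ 2 * q)); rewrite -?qdef.
have X0 : X = 0.
  move/eqP: Z0; rewrite mulf_eq0 (negPf fn0) orbF mulf_eq0 => /orP[|/eqP//].
  by rewrite -polyC_natr polyC_eq0 pnatr_eq0.
have gfq : g = 4 * f ^+ 2 * q.
  move/eqP: YZ; rewrite Z0 X0 expr0n mulr0 subr0 sqrf_eq0 subr_eq0 => /eqP.
  by [].
have gapGE x : gapG 1 x = 4 * (x1 + x2 * x) ^+ 2 * (m ^+ 2 + (n + r * x) ^+ 2).
  by rewrite -gE gfq -polyC_natr !(hornerE, horner_exp) /= fE qE.
have meanTEq x : meanT 1 x = (x1 + x2 * x) ^+ 2 + (m ^+ 2 + (n + r * x) ^+ 2).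
  rewrite -tauE -fE -qE; apply/eqP; rewrite eq_sym -subr_eq0; apply/eqP.
  by have := congr1 (fun p => p.[x]) X0; rewrite /X horner0 !(hornerE, horner_exp).
have x20 : x2 = 0.
  (* A fourth difference: [gapG 1] is quadratic, while the quartic in [gapGE] has leading
     coefficient 4 (x2 r)^2, and 96 = 4 . 4!. *)
  have : 96 * (x2 * r) ^+ 2 = 0.
    have := gapGE 0; have := gapGE 1; have := gapGE (-1).
    have := gapGE 2; have := gapGE (-2); rewrite /gapG; lra.
  move/eqP; rewrite mulf_eq0 pnatr_eq0 /= sqrf_eq0 mulf_eq0 (gt_eqF r0) orbF.
  by move/eqP.
have x10 : 0 < `|x1|.
  rewrite normr_gt0; apply: contra fn0 => /eqP x10.
  apply/eqP; apply: (@poly_itv_eq0 _ _ 0 1) => // e _ _.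
  by rewrite fE x10 x20 mul0r addr0.
exists `|x1|, m, n, r; split => // a s.
rewrite !exprMn !real_normK ?num_real //.
(* A binary quadratic form is determined by its values at [(1, 0)], [(1, 1)] and [(1, -1)], so the
   identities extend from [c = 1] to all [(c, s)]. *)
have quadM : meanT a s = a ^+ 2 * meanT 1 0 +
    a * s * ((meanT 1 1 - meanT 1 (-1)) / 2) +
    s ^+ 2 * ((meanT 1 1 + meanT 1 (-1)) / 2 - meanT 1 0).
  by rewrite /meanT; field.
have quadG : gapG a s = a ^+ 2 * gapG 1 0 +
    a * s * ((gapG 1 1 - gapG 1 (-1)) / 2) +
    s ^+ 2 * ((gapG 1 1 + gapG 1 (-1)) / 2 - gapG 1 0).
  by rewrite /gapG; field.
by rewrite quadM quadG !meanTEq !gapGE x20; split; field.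
Qed.

End Necessity.

(** * Spectra of A and Im B *)

Section Spectra.
Variables (R : realType) (u v h0 h1 h2 h3 k0 k1 k2 k3 : R).

Local Notation B := (pauli_mx h0 h1 h2 h3 k0 k1 k2 k3).
Local Notation p1 := (normal1 h0 h1 h2 h3 k0 k1 k2 k3).
Local Notation p2 := (normal2 h0 h1 h2 h3 k0 k1 k2 k3).
Local Notation p3 := (normal3 h0 h1 h2 h3 k0 k1 k2 k3).
Local Notation kk := (k1 ^+ 2 + k2 ^+ 2 + k3 ^+ 2).
Local Notation pk := (p1 * k1 + p2 * k2 + p3 * k3).
Local Notation pp := (p1 ^+ 2 + p2 ^+ 2 + p3 ^+ 2).
Local Notation hk := ((h2 * k3 - h3 * k2) ^+ 2 + (h3 * k1 - h1 * k3) ^+ 2 +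
  (h1 * k2 - h2 * k1) ^+ 2).

Lemma pauli00 : B 0 0 = (h0 + h3) +i* (k0 + k3). Proof. by rewrite mxE. Qed.
Lemma pauli01 : B 0 1 = (h1 + k2) +i* (k1 - h2). Proof. by rewrite mxE. Qed.
Lemma pauli10 : B 1 0 = (h1 - k2) +i* (h2 + k1). Proof. by rewrite mxE. Qed.
Lemma pauli11 : B 1 1 = (h0 - h3) +i* (k0 - k3). Proof. by rewrite mxE. Qed.

(** [B] is normal exactly when H and K commute, and their commutator is 2i (h x k).sigma; [hk] is
    the squared norm of the cross product h x k. *)
Lemma normal_pauli : B \is normalmx <-> hk = 0.
Proof.
move: pauli00 pauli01 pauli10 pauli11; set M := pauli_mx _ _ _ _ _ _ _ _.
clearbody M => b00 b01 b10 b11.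
have E : (M \is normalmx) <-> M *m M^t* = M^t* *m M.
  by split=> [/normalmxP|/normalmxP].
have tE i j : M^t* i j = conjc (M j i) by rewrite !mxE.
rewrite E {E}; split=> [/matrixP e|e].
  have := e 0 0; have := e 0 1; rewrite !mulmx2 !tE b00 b01 b10 b11 /= => -[e1 e2] [e3 _].
  have -> : h2 * k3 - h3 * k2 = 0 by lra.
  have -> : h3 * k1 - h1 * k3 = 0 by lra.
  have -> : h1 * k2 - h2 * k1 = 0 by lra.
  by ring.
have [e1 e2 e3] := sum3_sqr_eq0 e.
apply/matrixP; apply: ord2P; apply: ord2P; rewrite !mulmx2 !tE ?b00 ?b01 ?b10 ?b11 /=;
  congr (_ +i* _) => /=; lra.
Qed.

(** The Gram determinant of p and k is |p x k|^2, where p x k is the sum of the orthogonal vectors 2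
    h0 (h x k) and -2 (h x k) x k. It controls the definiteness of [gapG]. *)
Lemma gram_pauli : pp * kk - pk ^+ 2 = 4 * (hk * (h0 ^+ 2 + kk)).
Proof. by rewrite /normal1 /normal2 /normal3; ring. Qed.

Lemma Immx_spectrum b1 b2 : eigenvalues_are (Immx B) [:: b1; b2] ->
  (b1 - b2) ^+ 2 = (4 * kk)%:C.
Proof.
move=> /char_poly2 [s d].
have -> : (b1 - b2) ^+ 2 = (b1 + b2) ^+ 2 - 4 * (b1 * b2) by ring.
have c2 : (2 * 'i)^-1 = 0 +i* (- 2^-1) :> R[i].
  apply: (@mulrI _ (2 * 'i)).
    rewrite unitfE mulf_neq0 ?pnatr_eq0 //.
    by rewrite eq_complex /= oner_eq0 andbF.
  rewrite divff; last by rewrite mulf_neq0 ?pnatr_eq0 // eq_complex /= oner_eq0 andbF.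
  by congr (_ +i* _) => /=; field.
have I00 : Immx B 0 0 = (k0 + k3)%:C.
  by rewrite /Immx c2 !mxE /=; congr (_ +i* _) => /=; field.
have I11 : Immx B 1 1 = (k0 - k3)%:C.
  by rewrite /Immx c2 !mxE /=; congr (_ +i* _) => /=; field.
have I01 : Immx B 0 1 = k1 +i* (- k2).
  by rewrite /Immx c2 !mxE /=; congr (_ +i* _) => /=; field.
have I10 : Immx B 1 0 = k1 +i* k2.
  by rewrite /Immx c2 !mxE /=; congr (_ +i* _) => /=; field.
rewrite s d /mxtrace sum2 det2 I00 I11 I01 I10.
by congr (_ +i* _) => /=; ring.
Qed.

Lemma blockA_char_poly (al : R[i]) (M N : 'M[R[i]]_2) :
  char_poly (block_mx al%:M N M (- al%:M)) =
  ('X ^+ 2 - (al ^+ 2)%:P) ^+ 2 - (\tr (N *m M))%:P * ('X ^+ 2 - (al ^+ 2)%:P)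
  + (\det N * \det M)%:P.
Proof.
(* Right multiplication by the block matrix with rows [(d, 0)] and [(Mp, 1)], of determinant
   [d ^+ 2], makes the characteristic matrix block upper triangular; [d ^+ 2] is cancelled at the
   end. *)
pose d : {poly R[i]} := 'X + al%:P; pose a : {poly R[i]} := 'X - al%:P.
pose Np := map_mx polyC N; pose Mp := map_mx polyC M.
have dn0 : d ^+ 2 != 0.
  by rewrite sqrf_eq0 /d -[al]opprK polyCN polyXsubC_eq0.
have E : char_poly_mx (block_mx al%:M N M (- al%:M)) = block_mx a%:M (- Np) (- Mp) d%:M.
  rewrite /char_poly_mx map_block_mx (@scalar_mx_block _ 2 2) opp_block_mx add_block_mx.
  rewrite !add0r /a /d; congr block_mx; first by rewrite map_scalar_mx raddfB.
  by rewrite map_mxN map_scalar_mx opprK raddfD.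
rewrite /char_poly E; apply: (mulIf dn0).
have dL : \det (block_mx d%:M 0 Mp 1%:M : 'M[{poly R[i]}]_(2 + 2)) = d ^+ 2.
  by rewrite det_lblock det_scalar det1 mulr1.
rewrite -{1}dL -det_mulmx mulmx_block.
have -> : - Mp *m d%:M + d%:M *m Mp = 0.
  by rewrite mulNmx mul_mx_scalar mul_scalar_mx addNr.
rewrite det_ublock !mulmx0 !add0r mulmx1 det_scalar; congr (_ * _).
rewrite det2 /mxtrace sum2 !mxE !sum2 !det2 !mxE /= /a /d.
rewrite ?(mulr1n, mulr0n, polyCD, polyCM, polyCB, polyCN); ring.
Qed.

Lemma biquadratic_roots (K : comNzRingType) (al T D s1 s2 : K) :
  (forall x, (x ^+ 2 - al ^+ 2) ^+ 2 - T * (x ^+ 2 - al ^+ 2) + D =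
    (x ^+ 2 - s1 ^+ 2) * (x ^+ 2 - s2 ^+ 2)) ->
  s1 ^+ 2 + s2 ^+ 2 = 2 * al ^+ 2 + T /\
  (s1 ^+ 2 - s2 ^+ 2) ^+ 2 = T ^+ 2 - 4 * D.
Proof.
move=> ev.
have S : s1 ^+ 2 + s2 ^+ 2 = 2 * al ^+ 2 + T.
  have -> : s1 ^+ 2 + s2 ^+ 2 = 1 + (0 ^+ 2 - s1 ^+ 2) * (0 ^+ 2 - s2 ^+ 2) -
    (1 ^+ 2 - s1 ^+ 2) * (1 ^+ 2 - s2 ^+ 2) by ring.
  by rewrite -!ev; ring.
split=> //.
have -> : (s1 ^+ 2 - s2 ^+ 2) ^+ 2 = (s1 ^+ 2 + s2 ^+ 2) ^+ 2 -
  4 * ((0 ^+ 2 - s1 ^+ 2) * (0 ^+ 2 - s2 ^+ 2)) by ring.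
by rewrite -ev S; ring.
Qed.

(** The right-hand sides are 2 T(1, i) and 4 G(1, i), for the forms [meanT] and [gapG]: at
    [(c, s) = (1, i)] the matrix c Re A + s Im A is [A] itself. *)
Lemma blockA_spectrum s1 s2 :
  eigenvalues_are (blockA (u +i* v) B) [:: s1; - s1; s2; - s2] ->
  s1 ^+ 2 + s2 ^+ 2 =
    (2 * (u ^+ 2 + h0 ^+ 2 + h1 ^+ 2 + h2 ^+ 2 + h3 ^+ 2 + k0 ^+ 2 + kk - (1 + v ^+ 2)))
    +i* (4 * (u * v + k0)) /\
  (s1 ^+ 2 - s2 ^+ 2) ^+ 2 = (4 * (pp - 4 * kk)) +i* (16 * pk).
Proof.
rewrite /eigenvalues_are /blockA blockA_char_poly.
set al := u +i* v; set T := \tr _; set D := (\det _ * _).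
rewrite !big_cons big_nil mulr1 !polyCN !opprK => E.
have ev x : (x ^+ 2 - al ^+ 2) ^+ 2 - T * (x ^+ 2 - al ^+ 2) + D =
    (x ^+ 2 - s1 ^+ 2) * (x ^+ 2 - s2 ^+ 2).
  have := congr1 (fun p => p.[x]) E; rewrite !(hornerE, horner_exp) /= => ->.
  by ring.
have [S dS] := biquadratic_roots ev.
have tE i j : (B^t* + 1%:M) i j = conjc (B j i) + (i == j)%:R by rewrite !mxE.
have mE i j : (B - 1%:M) i j = B i j - (i == j)%:R by rewrite !mxE.
have TE : T = (2 * (h0 ^+ 2 + h1 ^+ 2 + h2 ^+ 2 + h3 ^+ 2 + k0 ^+ 2 + kk - 1)) +i* (4 * k0).
  rewrite /T /mxtrace sum2 !mulmx2 !tE !mE pauli00 pauli01 pauli10 pauli11 /=.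
  by congr (_ +i* _) => /=; ring.
rewrite S dS TE /D !det2 !tE !mE pauli00 pauli01 pauli10 pauli11 /= /al.
by split; congr (_ +i* _) => /=; rewrite ?/normal1 ?/normal2 ?/normal3; ring.
Qed.

End Spectra.

(** * The characterization for a general matrix B *)

Lemma pauli_decomposition (R : realType) (B : 'M[R[i]]_2) :
  exists h0 h1 h2 h3 k0 k1 k2 k3, B = pauli_mx h0 h1 h2 h3 k0 k1 k2 k3.
Proof.
exists ((Re (B 0 0) + Re (B 1 1)) / 2), ((Re (B 0 1) + Re (B 1 0)) / 2),
  ((Im (B 1 0) - Im (B 0 1)) / 2), ((Re (B 0 0) - Re (B 1 1)) / 2),
  ((Im (B 0 0) + Im (B 1 1)) / 2), ((Im (B 0 1) + Im (B 1 0)) / 2),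
  ((Re (B 0 1) - Re (B 1 0)) / 2), ((Im (B 0 0) - Im (B 1 1)) / 2).
apply/matrixP; apply: ord2P; apply: ord2P; rewrite mxE /= [LHS]complex_eta;
  by congr (_ +i* _); field.
Qed.

Theorem theorem2 (R : realType) (u v : R) (B : 'M[R[i]]_2)
    (beta1 beta2 sigma1 sigma2 : R[i])
    (hbeta : eigenvalues_are (Immx B) [:: beta1; beta2])
    (hsigma : eigenvalues_are (blockA (u +i* v) B)
                [:: sigma1; - sigma1; sigma2; - sigma2]) :
  bielliptical (numerical_range (blockA (u +i* v) B)) <->
  ~ (B \is normalmx) /\
  (exists s1 s2 : R[i],
     [/\ s1 = sigma1 \/ s1 = - sigma1,
         s2 = sigma2 \/ s2 = - sigma2 &
         (1 + v ^+ 2)%:C * (s1 + s2) ^+ 2 = (beta1 - beta2) ^+ 2]).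
Proof.
have [h0 [h1 [h2 [h3 [k0 [k1 [k2 [k3 BE]]]]]]]] := pauli_decomposition B.
subst B; rewrite (Immx_spectrum hbeta) normal_pauli.
have [sumE difE] := blockA_spectrum hsigma.
have gram := gram_pauli h0 h1 h2 h3 k0 k1 k2 k3.
set p1 := normal1 h0 h1 h2 h3 k0 k1 k2 k3 in difE gram *.
set p2 := normal2 h0 h1 h2 h3 k0 k1 k2 k3 in difE gram *.
set p3 := normal3 h0 h1 h2 h3 k0 k1 k2 k3 in difE gram *.
set kk := k1 ^+ 2 + k2 ^+ 2 + k3 ^+ 2 in sumE difE gram *.
set pk := p1 * k1 + p2 * k2 + p3 * k3 in difE gram *.
set pp := p1 ^+ 2 + p2 ^+ 2 + p3 ^+ 2 in difE gram *.
set hk := (X in X = 0); rewrite -/hk in gram.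
set mu := u ^+ 2 + h0 ^+ 2 + h1 ^+ 2 + h2 ^+ 2 + h3 ^+ 2 + k0 ^+ 2 + kk in sumE.
have meanTE c s : meanT u v h0 h1 h2 h3 k0 k1 k2 k3 c s =
    c ^+ 2 * mu + 2 * c * s * (u * v + k0) + s ^+ 2 * (1 + v ^+ 2).
  by rewrite /meanT /mu /kk; ring.
have gapGE c s : gapG h0 h1 h2 h3 k0 k1 k2 k3 c s =
    c ^+ 2 * pp + 4 * c * s * pk + 4 * s ^+ 2 * kk.
  by rewrite /gapG /pp /pk /kk -/p1 -/p2 -/p3; ring.
have kk0 : 0 <= kk by rewrite !addr_ge0 ?sqr_ge0.
have hk0 : 0 <= hk by rewrite !addr_ge0 ?sqr_ge0.
have v0 : 0 < 1 + v ^+ 2 by rewrite ltr_wpDr ?sqr_ge0.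
clearbody mu p1 p2 p3.
split=> [/bielliptical_range_split [t [m [n [r [[t0 m0 r0] H]]]]]|].
  have [M00 G00] := H 1 0; have [M01 G01] := H 0 1; have [M11 G11] := H 1 1.
  rewrite !meanTE in M00 M01 M11; rewrite !gapGE in G00 G01 G11.
  have muE : mu = t ^+ 2 + m ^+ 2 + n ^+ 2 by lra.
  have r2 : 1 + v ^+ 2 = r ^+ 2 by lra.
  have nr : u * v + k0 = n * r by lra.
  have ppE : pp = 4 * t ^+ 2 * (m ^+ 2 + n ^+ 2) by lra.
  have kkE : kk = (t * r) ^+ 2 by lra.
  have pkE : pk = 2 * t ^+ 2 * n * r by lra.
  split.
    (* The Gram determinant equals 4 (t^2 m r)^2, which is positive, so h x k is nonzero. *)
    move=> hkz; move: gram; rewrite hkz mul0r mulr0 ppE pkE kkE => e.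
    have : 0 < 4 * (t ^+ 2 * m * r) ^+ 2.
      by rewrite mulr_gt0 // exprn_gt0 // !mulr_gt0 // exprn_gt0.
    suff -> : 4 * (t ^+ 2 * m * r) ^+ 2 = 0 by rewrite ltxx.
    by rewrite -e; ring.
  (* With q the value of the ellipse form at [(1, i)], the squared eigenvalues are (t + sqrt q)^2
     and (t - sqrt q)^2. Their roots have product [w = t^2 - q] once a sign is fixed, and then the
     square of the sum is 4 t^2. *)
  pose w : R[i] := (t ^+ 2 - (m ^+ 2 + n ^+ 2 - r ^+ 2)) +i* (- (2 * n * r)).
  have prod2 : (sigma1 * sigma2) ^+ 2 = w ^+ 2.
    have : 4 * (sigma1 * sigma2) ^+ 2 = 4 * w ^+ 2.
      have -> : 4 * (sigma1 * sigma2) ^+ 2 =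
        (sigma1 ^+ 2 + sigma2 ^+ 2) ^+ 2 - (sigma1 ^+ 2 - sigma2 ^+ 2) ^+ 2 by ring.
      rewrite sumE difE muE r2 nr ppE kkE pkE /w.
      by congr (_ +i* _) => /=; ring.
    by apply: mulfI; rewrite pnatr_eq0.
  have [s2 [s2E s2w]] : exists s2, (s2 = sigma2 \/ s2 = - sigma2) /\ sigma1 * s2 = w.
    move/eqP: prod2; rewrite eqf_sqr => /orP[]/eqP e.
      by exists sigma2; split; first by left.
    by exists (- sigma2); split; [right|rewrite mulrN e opprK].
  exists sigma1, s2; split => //; first by left.
  have -> : (sigma1 + s2) ^+ 2 = sigma1 ^+ 2 + sigma2 ^+ 2 + 2 * w.
    by rewrite -s2w; case: s2E => ->; ring.
  rewrite sumE muE r2 nr kkE /w.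
  by congr (_ +i* _) => /=; ring.
move=> [nn [s1 [s2 [s1E s2E E]]]].
have hkp : 0 < hk by rewrite lt_neqAle eq_sym hk0 andbT; apply/eqP.
have kkp : 0 < kk.
  rewrite lt_neqAle kk0 andbT eq_sym; apply/eqP => kkz; apply: nn.
  have [k10 k20 k30] := sum3_sqr_eq0 kkz.
  by rewrite /hk k10 k20 k30; ring.
clear nn; clearbody kk pk pp hk.
(* The values of [r], [t], [n], [m] are forced by comparing coefficients in G = 4 t^2 q and the
   coefficient of s^2 in T. *)
pose r := Num.sqrt (1 + v ^+ 2); pose t := Num.sqrt kk / r.
have r0 : 0 < r by rewrite sqrtr_gt0.
have r2 : r ^+ 2 = 1 + v ^+ 2 by rewrite sqr_sqrtr // ltW.
have t0 : 0 < t by rewrite divr_gt0 // sqrtr_gt0.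
have [tn rn] : t != 0 /\ r != 0 by rewrite !gt_eqF.
have kkE : kk = (t * r) ^+ 2 by rewrite /t divfK // sqr_sqrtr // ltW.
clearbody t r.
pose n := pk / (2 * t ^+ 2 * r).
have pkE : pk = 2 * t ^+ 2 * n * r by rewrite /n; field; rewrite tn rn.
have m20 : 0 < pp / (4 * t ^+ 2) - n ^+ 2.
  have -> : pp / (4 * t ^+ 2) - n ^+ 2 = (pp * kk - pk ^+ 2) / (4 * t ^+ 4 * r ^+ 2).
    by rewrite kkE pkE; field; rewrite tn rn.
  rewrite gram divr_gt0 ?mulr_gt0 ?exprn_gt0 //.
  by rewrite ltr_wpDl ?sqr_ge0.
pose m := Num.sqrt (pp / (4 * t ^+ 2) - n ^+ 2).
have m0 : 0 < m by rewrite sqrtr_gt0.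
have m2 : m ^+ 2 = pp / (4 * t ^+ 2) - n ^+ 2 by rewrite sqr_sqrtr // ltW.
have ppE : pp = 4 * t ^+ 2 * (m ^+ 2 + n ^+ 2) by rewrite m2; field.
clearbody n m.
pose q : R[i] := (m ^+ 2 + n ^+ 2 - r ^+ 2) +i* (2 * n * r).
have t2 : (t ^+ 2)%:C != 0 :> R[i].
  by rewrite eq_complex /= eqxx andbT sqrf_eq0.
have sum4 : (s1 + s2) ^+ 2 = 4 * (t ^+ 2)%:C.
  apply: (@mulfI _ (r ^+ 2)%:C); first by rewrite eq_complex /= eqxx andbT sqrf_eq0.
  by rewrite r2 E kkE -r2; congr (_ +i* _) => /=; ring.
have s1q : s1 ^+ 2 = sigma1 ^+ 2 by case: s1E => ->; rewrite ?sqrrN.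
have s2q : s2 ^+ 2 = sigma2 ^+ 2 by case: s2E => ->; rewrite ?sqrrN.
(* The product of the squared sum and squared difference is 4 G(1, i) = 16 t^2 q. Adding the two
   squares then recovers T(1, i), whose real and imaginary parts are the missing coefficients of
   T. *)
have dif4 : (s1 - s2) ^+ 2 = 4 * q.
  apply: (@mulfI _ (4 * (t ^+ 2)%:C)); first by rewrite mulf_neq0 // pnatr_eq0.
  rewrite -{1}sum4 -exprMn mulrC -subr_sqr s1q s2q difE ppE kkE pkE /q.
  by congr (_ +i* _) => /=; ring.
have : sigma1 ^+ 2 + sigma2 ^+ 2 = 2 * ((t ^+ 2)%:C + q).
  apply: (@mulfI _ 2); first by rewrite pnatr_eq0.
  have -> : 2 * (2 * ((t ^+ 2)%:C + q)) = 4 * (t ^+ 2)%:C + 4 * q by ring.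
  by rewrite -sum4 -dif4 -s1q -s2q; ring.
rewrite sumE /q => -[e1 e2].
have muE : mu = t ^+ 2 + m ^+ 2 + n ^+ 2 by lra.
have nr : u * v + k0 = n * r by lra.
apply: (@bielliptical_range R u v h0 h1 h2 h3 k0 k1 k2 k3 t m n r) => // c s.
  by rewrite meanTE muE nr -r2; ring.
by rewrite gapGE ppE pkE kkE; ring.
Qed.
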